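(* Let $\mathcal M$ be an o-minimal structure in a language $\mathcal L$, with universe $M$, and let $\mathcal N$ be an expansion of $\mathcal M$ such that (a) every open definable set is $\mathcal L$-definable, and (b) $\mathcal N$ admits a dimension function $\dim$ compatible with $\mathcal M$. Let $G$ be a definable group. Then $G$ is definably isomorphic to a group definable in $\mathcal M$ if and only if $G$ is definably isomorphic to a strongly large group.
   Context: ''Definable'' means definable in $\mathcal N$ with parameters; ''$\mathcal L$-definable'' means definable in $\mathcal M$ with parameters. A definable group is a group whose universe (a subset of some $M^n$) and group operation are definable; a definable isomorphism is a group isomorphism whose graph is definable. A dimension function compatible with $\mathcal M$ is a map $\dim$ from the class of all definable sets to $\{-\infty\}\cup\mathbb N$ such that for all definable $X,Y\subseteq M^n$ and $a\in M$: (D1) $\dim\{a\}=0$, $\dim M=1$, and $\dim X=-\infty$ iff $X=\emptyset$; (D2) $\dim(X\cup Y)=\max\{\dim X,\dim Y\}$; (D3) if $\{X_t\}_{t\in I}$ is a definable family of pairwise disjoint sets, then (a) for each $d\in\{-\infty\}\cup\mathbb N$ the set $\{t\in I:\dim X_t=d\}$ is definable, and (b) if every $X_t$ has dimension $k$ then $\dim\bigcup_{t\in I}X_t=\dim I+k$; (D4) if $f:X\to Y$ is a definable bijection then $\dim X=\dim Y$; (D5) the dimension of every $\mathcal L$-definable set equals its o-minimal dimension; (D6) every definable map $f:M^n\to M$ agrees with an $\mathcal L$-definable map $F:M^n\to M$ outside a definable set of dimension $<n$. Topology is the order (product) topology; $cl(X)$ denotes topological closure. A definable set $X$ is strongly large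 if $\dim X=\dim cl(X)$ (the latter being the o-minimal dimension of the $\mathcal L$-definable set $cl(X)$); a definable group is strongly large if its universe is. *)

(* Defs.v *)
From Stdlib Require List.
From mathcomp Require Import all_boot.

Set Implicit Arguments. Unset Strict Implicit. Unset Printing Implicit Defensive.

Definition pt (M : Type) (n : nat) := 'I_n -> M.
Definition pset (M : Type) (n : nat) := pt M n -> Prop.
(* a "definability system": for each n, which subsets of M^n are definable *)
Definition dsys (M : Type) := forall n, pset M n -> Prop.

Definition lpart M n m (z : pt M (n + m)) : pt M n := fun i => z (lshift m i).
Definition rpart M n m (z : pt M (n + m)) : pt M m := fun j => z (rshift n j).
Definition catp M n m (x : pt M n) (y : pt M m) : pt M (n + m) :=
  fun i => match fintype.split i with inl j => x j | inr k => y k end.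

(* The collection of parameter-definable sets of a first-order structure with
   universe M is exactly a family closed under these operations
   (van den Dries' notion of a "structure"). *)
Record is_structure (M : Type) (S : dsys M) : Prop := {
  st_ext : forall n (A B : pset M n), (forall x, A x <-> B x) -> S n A -> S n B;
  st_empty : forall n, S n (fun _ => False);
  st_compl : forall n A, S n A -> S n (fun x => ~ A x);
  st_union : forall n A B, S n A -> S n B -> S n (fun x => A x \/ B x);
  st_pullback : forall n m (s : 'I_n -> 'I_m) (A : pset M n),
      S n A -> S m (fun y => A (fun i => y (s i)));
  st_proj : forall n (A : pset M (n + 1)),
      S (n + 1) A -> S n (fun x => exists a : M, A (catp x (fun _ : 'I_1 => a)));
  st_diag : S 2 (fun x => x ord0 = x ord_max);
  st_point : forall a : M, S 1 (fun x => x ord0 = a) }.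

Record dlo (M : Type) (lt : M -> M -> Prop) : Prop := {
  lt_irr : forall x, ~ lt x x;
  lt_trans : forall x y z, lt x y -> lt y z -> lt x z;
  lt_total : forall x y, lt x y \/ x = y \/ lt y x;
  lt_dense : forall x y, lt x y -> exists z, lt x z /\ lt z y;
  lt_nomax : forall x, exists y, lt x y;
  lt_nomin : forall x, exists y, lt y x }.

Definition in_interval M (lt : M -> M -> Prop) (a b : option M) (x : M) : Prop :=
  (match a with Some a => lt a x | None => True end) /\
  (match b with Some b => lt x b | None => True end).

Definition ominimal M (lt : M -> M -> Prop) (S : dsys M) : Prop :=
  is_structure S /\
  S 2 (fun x => lt (x ord0) (x ord_max)) /\
  forall A : pset M 1, S 1 A ->
    exists (ps : list M) (ivs : list (option M * option M)),
      forall x : pt M 1, A x <->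
        (List.In (x ord0) ps \/
         exists ab, List.In ab ivs /\ in_interval lt ab.1 ab.2 (x ord0)).

Definition box M (lt : M -> M -> Prop) n (a b x : pt M n) : Prop :=
  forall i, lt (a i) (x i) /\ lt (x i) (b i).
Definition is_open M (lt : M -> M -> Prop) n (X : pset M n) : Prop :=
  forall x, X x -> exists a b, box lt a b x /\ forall y, box lt a b y -> X y.
Definition closure M (lt : M -> M -> Prop) n (X : pset M n) : pset M n :=
  fun x => forall a b, box lt a b x -> exists y, box lt a b y /\ X y.
Definition has_interior M (lt : M -> M -> Prop) n (X : pset M n) : Prop :=
  exists a b x, box lt a b x /\ forall y, box lt a b y -> X y.

Definition cproj M n k (s : 'I_k -> 'I_n) (X : pset M n) : pset M k :=
  fun y => exists x, X x /\ forall i, y i = x (s i).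

Definition is_odim M (lt : M -> M -> Prop) n (X : pset M n) (d : option nat) : Prop :=
  match d with
  | None => forall x, ~ X x
  | Some k =>
      (exists s : 'I_k -> 'I_n, injective s /\ has_interior lt (cproj s X)) /\
      (forall k' (s : 'I_k' -> 'I_n), injective s ->
          has_interior lt (cproj s X) -> k' <= k)
  end.

(* arithmetic on {-oo} ∪ N, -oo = None *)
Definition dadd (d e : option nat) : option nat :=
  match d, e with Some a, Some b => Some (a + b) | _, _ => None end.
Definition dmax (d e : option nat) : option nat :=
  match d, e with
  | Some a, Some b => Some (maxn a b)
  | Some a, None => Some a
  | None, e => e end.
Definition dlt (d : option nat) (n : nat) : Prop :=
  match d with None => True | Some k => k < n end.

Definition fiber M m n (Z : pset M (m + n)) (t : pt M m) : pset M n :=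
  fun x => Z (catp t x).

Record dim_fun M (lt : M -> M -> Prop) (SM SN : dsys M)
    (dim : forall n, pset M n -> option nat) : Prop := {
  D1_point : forall a : M, dim 1 (fun x => x ord0 = a) = Some 0;
  D1_line : dim 1 (fun _ => True) = Some 1;
  D1_empty : forall n (X : pset M n), SN n X -> (dim n X = None <-> forall x, ~ X x);
  D2 : forall n (X Y : pset M n), SN n X -> SN n Y ->
       dim n (fun x => X x \/ Y x) = dmax (dim n X) (dim n Y);
  D3a : forall m n (I : pset M m) (Z : pset M (m + n)), SN m I -> SN (m + n) Z ->
        forall d, SN m (fun t => I t /\ dim n (fiber Z t) = d);
  D3b : forall m n (I : pset M m) (Z : pset M (m + n)) k, SN m I -> SN (m + n) Z ->
        (forall t t' x, I t -> I t' -> t <> t' -> fiber Z t x -> fiber Z t' x -> False) ->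
        (forall t, I t -> dim n (fiber Z t) = k) ->
        dim n (fun x => exists t, I t /\ fiber Z t x) = dadd (dim m I) k;
  D4 : forall n m (X : pset M n) (Y : pset M m) (f : pt M n -> pt M m),
       SN n X -> SN m Y ->
       SN (n + m) (fun z => X (lpart z) /\ f (lpart z) = rpart z) ->
       (forall x, X x -> Y (f x)) ->
       (forall x x', X x -> X x' -> f x = f x' -> x = x') ->
       (forall y, Y y -> exists x, X x /\ f x = y) ->
       dim n X = dim m Y;
  D5 : forall n (X : pset M n), SM n X -> is_odim lt X (dim n X);
  D6 : forall n (f : pt M n -> M),
       SN (n + 1) (fun z => f (lpart z) = rpart z ord0) ->
       exists F : pt M n -> M,
         SM (n + 1) (fun z => F (lpart z) = rpart z ord0) /\
         dlt (dim n (fun x => f x <> F x)) n }.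

Record dgroup M (S : dsys M) n (U : pset M n) (mul : pt M n -> pt M n -> pt M n) : Prop := {
  g_univ : S n U;
  g_op : S ((n + n) + n) (fun z => U (lpart (lpart z)) /\ U (rpart (lpart z)) /\
                                   mul (lpart (lpart z)) (rpart (lpart z)) = rpart z);
  g_closed : forall x y, U x -> U y -> U (mul x y);
  g_assoc : forall x y z, U x -> U y -> U z -> mul x (mul y z) = mul (mul x y) z;
  g_unit : exists e, U e /\ (forall x, U x -> mul e x = x /\ mul x e = x) /\
           forall x, U x -> exists y, U y /\ mul x y = e /\ mul y x = e }.

Definition def_iso M (S : dsys M) n m (U : pset M n) (mul : pt M n -> pt M n -> pt M n)
    (V : pset M m) (mul' : pt M m -> pt M m -> pt M m) (f : pt M n -> pt M m) : Prop :=
  S (n + m) (fun z => U (lpart z) /\ f (lpart z) = rpart z) /\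
  (forall x, U x -> V (f x)) /\
  (forall x x', U x -> U x' -> f x = f x' -> x = x') /\
  (forall y, V y -> exists x, U x /\ f x = y) /\
  (forall x y, U x -> U y -> f (mul x y) = mul' (f x) (f y)).

Definition strongly_large M (lt : M -> M -> Prop) (dim : forall n, pset M n -> option nat)
    n (X : pset M n) : Prop :=
  dim n X = dim n (closure lt X).

(* Main.v *)
(** For the forward direction, an L-definable set dense in a box has interior: the
    box is the union of the parts inside and outside the set, and by (D2) and (D5)
    one of the two has interior. Hence closures do not raise dimension.

    For the converse let [G] be strongly large of dimension [k]. Its closure is
    L-definable of dimension [k], and every definable map on it agrees with an
    L-definable one off a set of dimension [< k]: points lying in finite fibres of a
    coordinate projection to [M^k] are thickened to disjoint open regions, (D6) is
    applied to the thickened map, and the L-definable value at a point is recovered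
    as the generic value near it inside its region. This gives an L-definable set
    [W] equal to [G] up to dimension [< k] and an L-definable [F] with
    [F x y = x y] generically. A point [a] of [W], even outside [G], stands for
    the [h] in [G] with [F a y = h y] for almost all [y]; such an [h] exists as soon
    as [F a] is generically associative and injective, which is an L-definable
    condition. The elements so represented are almost all of [G], hence finitely
    many translates of them cover [G], and gluing the translates (equality of the
    represented elements being L-definable through germs) yields an L-definable
    group. *)
From Stdlib Require Import Classical ClassicalEpsilon FunctionalExtensionality PropExtensionality.
From mathcomp Require Import all_boot.
Require Import Defs.

Set Implicit Arguments. Unset Strict Implicit. Unset Printing Implicit Defensive.

(** * Splitting and concatenating points *)

Lemma lpart_catp M n m (x : pt M n) (y : pt M m) : lpart (catp x y) = x.
Proof.
apply: functional_extensionality => i; rewrite /lpart /catp.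
by rewrite -[lshift m i]/(unsplit (inl i)) unsplitK.
Qed.

Lemma rpart_catp M n m (x : pt M n) (y : pt M m) : rpart (catp x y) = y.
Proof.
apply: functional_extensionality => i; rewrite /rpart /catp.
by rewrite -[rshift n i]/(unsplit (inr i)) unsplitK.
Qed.

Lemma catp_parts M n m (z : pt M (n + m)) : catp (lpart z) (rpart z) = z.
Proof.
apply: functional_extensionality => i; rewrite /catp -{2}(splitK i).
by case: (fintype.split i).
Qed.

Lemma catp_eq M n m (x : pt M n) (y : pt M m) z :
  lpart z = x -> rpart z = y -> catp x y = z.
Proof. by move=> <- <-; rewrite catp_parts. Qed.

(** * Definable sets and maps *)

(** Types of points: [E] is identified with a power of [M] by listing coordinates. *)
Class co (M E : Type) := Co {
  cd : nat;
  cto : E -> pt M cd;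
  cof : pt M cd -> E;
  ctoK : forall x, cof (cto x) = x;
  cofK : forall z, cto (cof z) = z }.
Arguments cd {M} E {_}.

#[global] Instance co_base M : co M M.
Proof.
refine (@Co M M 1 (fun a _ => a) (fun z => z ord0) _ _) => // z.
by apply: functional_extensionality => i; rewrite ord1.
Defined.

#[global] Instance co_pt M n : co M (pt M n).
Proof. by refine (@Co M (pt M n) n id id _ _). Defined.

#[global] Instance co_prod M E F (cE : co M E) (cF : co M F) : co M (E * F).
Proof.
refine (@Co M (E * F) (cd E + cd F) (fun p => catp (cto p.1) (cto p.2))
  (fun z => (cof (lpart z), cof (rpart z))) _ _).
- by case=> x y; rewrite lpart_catp rpart_catp !ctoK.
- by move=> z; rewrite !cofK catp_parts.
Defined.

(** For [E = pt M n] this is [S n P] by conversion, and on products it unfolds to [lpart] and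
    [rpart]; the conditions of the theorem pass to [Def] and back without rewriting. *)
Definition Def M (S : dsys M) E {cE : co M E} (P : E -> Prop) : Prop :=
  S (cd E) (fun z => P (cof z)).

Definition DefFun M (S : dsys M) E F {cE : co M E} {cF : co M F} (g : E -> F) : Prop :=
  Def S (fun p : E * F => g p.1 = p.2).

(** Copairing of two coordinate renamings, used to describe maps on a product. *)
Definition osum n m p (f : 'I_n -> 'I_p) (g : 'I_m -> 'I_p) (j : 'I_(n + m)) : 'I_p :=
  match fintype.split j with inl a => f a | inr b => g b end.

Section Definability.
Variables (M : Type) (S : dsys M).
Hypothesis HS : is_structure S.

Section OneType.
Context {E : Type} {cE : co M E}.
Implicit Types P Q : E -> Prop.

Lemma Def_ext P Q : (forall x, P x <-> Q x) -> Def S P -> Def S Q.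
Proof. by move=> h; apply: (st_ext HS) => z; exact: h. Qed.

Lemma Def_not P : Def S P -> Def S (fun x => ~ P x).
Proof. exact: (st_compl HS). Qed.

Lemma Def_or P Q : Def S P -> Def S Q -> Def S (fun x => P x \/ Q x).
Proof. exact: (st_union HS). Qed.

Lemma Def_and P Q : Def S P -> Def S Q -> Def S (fun x => P x /\ Q x).
Proof.
move=> hP hQ; apply: Def_ext (Def_not (Def_or (Def_not hP) (Def_not hQ))) => x.
by split=> [h|]; [split; apply: NNPP => h'; apply: h; tauto | tauto].
Qed.

Lemma Def_imp P Q : Def S P -> Def S Q -> Def S (fun x => P x -> Q x).
Proof.
move=> hP hQ; apply: Def_ext (Def_or (Def_not hP) hQ) => x.
by split; [tauto | move=> h; case: (classic (P x)); tauto].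
Qed.

Lemma Def_prop (A : Prop) : Def S (fun _ : E => A).
Proof.
have h0 : Def S (fun _ : E => False) by exact: (st_empty HS (cd E)).
case: (classic A) => hA.
  by apply: Def_ext (Def_not h0) => x; split=> // _ [].
by apply: Def_ext h0 => x; split.
Qed.

Lemma Def_fall (I : finType) (P : I -> E -> Prop) :
  (forall i, Def S (P i)) -> Def S (fun x => forall i, P i x).
Proof.
move=> hP.
have h : forall s : seq I, Def S (fun x => forall i, i \in s -> P i x).
  elim=> [|j s IH]; first by apply: Def_ext (Def_prop True) => x; split.
  apply: Def_ext (Def_and (hP j) IH) => x; split=> [[h1 h2] i|h].
    by rewrite inE => /orP[/eqP->//|]; apply: h2.
  by split=> [|i hi]; apply: h; rewrite inE ?eqxx ?hi ?orbT.
by apply: Def_ext (h (enum I)) => x; split=> hx i => [|_]; apply: hx; rewrite ?mem_enum.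
Qed.

Lemma Def_fex (I : finType) (P : I -> E -> Prop) :
  (forall i, Def S (P i)) -> Def S (fun x => exists i, P i x).
Proof.
move=> hP; apply: Def_ext (Def_not (Def_fall (fun i => Def_not (hP i)))) => x.
by split=> [/not_all_not_ex|[i hi] h]; last exact: (h i).
Qed.
End OneType.

(** Induction on [m]: the structure axiom projects away one last coordinate at a time. The rest is
    the rebracketing of [n + m.+1] as [n + m + 1]. *)
Lemma ex_pt_definable n m (A : pset M (n + m)) :
  @S (n + m) A -> @S n (fun x => exists y : pt M m, A (catp x y)).
Proof.
elim: m n A => [|m IH] n A hA.
  have hB := st_pullback HS (cast_ord (addn0 n)) hA.
  apply: (st_ext HS) hB => x.
  have E0 (y : pt M 0) : catp x y = (fun i => x (cast_ord (addn0 n) i)).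
    apply: catp_eq; apply: functional_extensionality => -[i hi] //.
    by rewrite /lpart; congr x; apply: val_inj.
  split=> [h|[y]]; last by rewrite E0.
  by exists (fun i : 'I_0 => x (cast_ord (addn0 n) (rshift n i))); rewrite E0.
have e : (n + m.+1 = n + m + 1)%N by rewrite addn1 addnS.
have hB := IH _ _ (st_proj HS (st_pullback HS (cast_ord e) hA)).
apply: (st_ext HS) hB => x; split=> [[y [a h]]|[y h]].
  exists (fun i => catp y (fun _ : 'I_1 => a) (cast_ord (esym (addn1 m)) i)).
  suff -> : catp x (fun i => catp y (fun=> a) (cast_ord (esym (addn1 m)) i)) =
    (fun i => catp (catp x y) (fun=> a) (cast_ord e i)) by [].
  apply: catp_eq; apply: functional_extensionality => i.
    rewrite /lpart.
    have -> : cast_ord e (lshift m.+1 i) = lshift 1 (lshift m i) by apply: val_inj.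
    by rewrite -[LHS]/(lpart (lpart (catp (catp x y) (fun=> a))) i) !lpart_catp.
  rewrite /rpart; case: (fintype.splitP (cast_ord (esym (addn1 m)) i)) => j /= hj.
    have -> : cast_ord e (rshift n i) = lshift 1 (rshift n j) by apply: val_inj => /=; rewrite hj.
    have -> : cast_ord (esym (addn1 m)) i = lshift 1 j by apply: val_inj.
    rewrite -[LHS]/(rpart (lpart (catp (catp x y) (fun=> a))) j).
    by rewrite -[RHS]/(lpart (catp y (fun=> a)) j) !lpart_catp rpart_catp.
  have -> : cast_ord e (rshift n i) = rshift (n + m) j.
    by apply: val_inj => /=; rewrite hj addnA.
  have -> : cast_ord (esym (addn1 m)) i = rshift m j by apply: val_inj.
  rewrite -[LHS]/(rpart (catp (catp x y) (fun=> a)) j).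
  by rewrite -[RHS]/(rpart (catp y (fun=> a)) j) !rpart_catp.
exists (fun i => y (cast_ord (addn1 m) (lshift 1 i))), (y ord_max).
suff <- : catp x y = (fun i => catp (catp x (fun i0 => y (cast_ord (addn1 m) (lshift 1 i0))))
   (fun=> y ord_max) (cast_ord e i)) by [].
set y' := (fun i0 => y (cast_ord (addn1 m) (lshift 1 i0))); set z := catp x y'.
apply: catp_eq; apply: functional_extensionality => i.
  rewrite /lpart.
  have -> : cast_ord e (lshift m.+1 i) = lshift 1 (lshift m i) by apply: val_inj.
  by rewrite -[LHS]/(lpart (lpart (catp z (fun=> y ord_max))) i) !lpart_catp.
rewrite /rpart; case: (fintype.splitP (cast_ord (esym (addn1 m)) i)) => j /= hj.
  have -> : cast_ord e (rshift n i) = lshift 1 (rshift n j) by apply: val_inj => /=; rewrite hj.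
  rewrite -[LHS]/(rpart (lpart (catp z (fun=> y ord_max))) j) lpart_catp rpart_catp.
  by congr y; apply: val_inj.
have -> : cast_ord e (rshift n i) = rshift (n + m) j.
  by apply: val_inj => /=; rewrite hj addnA.
rewrite -[LHS]/(rpart (catp z (fun=> y ord_max)) j) rpart_catp.
by congr y; apply: val_inj => /=; rewrite hj (ord1 j) addn0.
Qed.

Section TwoTypes.
Context {E F : Type} {cE : co M E} {cF : co M F}.

Lemma Def_ex (P : E -> F -> Prop) :
  Def S (fun p : E * F => P p.1 p.2) -> Def S (fun x => exists y, P x y).
Proof.
move=> hP; apply: (st_ext HS) (ex_pt_definable hP) => z /=; split=> [[w]|[y h]].
  by rewrite lpart_catp rpart_catp => h; exists (cof w).
by exists (cto y); rewrite lpart_catp rpart_catp ctoK.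
Qed.

Lemma Def_all (P : E -> F -> Prop) :
  Def S (fun p : E * F => P p.1 p.2) -> Def S (fun x => forall y, P x y).
Proof.
move=> hP; have h := Def_not (@Def_ex (fun x y => ~ P x y) (Def_not hP)).
apply: Def_ext h => x; split=> [h y|h [y hy]]; last exact: hy.
by apply: NNPP => hy; apply: h; exists y.
Qed.

(** Serves maps [g] that only permute, repeat or drop coordinates: [r] tells from which coordinate
    of the argument each coordinate of the value is copied. *)
Lemma Def_rename (g : E -> F) (r : 'I_(cd F) -> 'I_(cd E)) (P : F -> Prop) :
  (forall z i, cto (g (cof z)) i = z (r i)) -> Def S P -> Def S (fun x => P (g x)).
Proof.
move=> hg hP; apply: (st_ext HS) (st_pullback HS r hP) => z.
suff -> : (fun i => z (r i)) = cto (g (cof z)) by rewrite ctoK.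
by apply: functional_extensionality => i; rewrite hg.
Qed.
End TwoTypes.

Lemma Def_diag {E} {cE : co M E} : Def S (fun p : E * E => p.1 = p.2).
Proof.
have h : Def S (fun p : E * E => forall i, cto p.1 i = cto p.2 i).
  apply: Def_fall => i.
  pose r (j : 'I_2) : 'I_(cd E + cd E) := if j == ord0 then lshift _ i else rshift _ i.
  apply: (st_ext HS) (st_pullback HS r (st_diag HS)) => z.
  by rewrite /r /= !cofK.
apply: Def_ext h => -[x y] /=; split=> [h|-> //].
by rewrite -(ctoK x) -(ctoK y); congr cof; apply: functional_extensionality.
Qed.

Lemma DefFun_rename {E F} {cE : co M E} {cF : co M F} (g : E -> F) (r : 'I_(cd F) -> 'I_(cd E)) :
  (forall z i, cto (g (cof z)) i = z (r i)) -> DefFun S g.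
Proof.
move=> hg.
have h := @Def_rename _ _ (co_prod cE cF) (co_prod cF cF) (fun p => (g p.1, p.2))
    (osum (fun a => lshift _ (r a)) (fun b => rshift _ b))
    (fun p => p.1 = p.2).
apply: h Def_diag => z i /=; rewrite /osum /catp.
by case: (fintype.split i) => a; rewrite ?hg ?cofK.
Qed.
Lemma DefFun_id {E} {cE : co M E} : DefFun S (fun x : E => x).
Proof. by apply: (@DefFun_rename _ _ _ _ _ id) => z i; rewrite cofK. Qed.

Lemma DefFun_fst0 {E F} {cE : co M E} {cF : co M F} : DefFun S (fun x : E * F => x.1).
Proof. by apply: (@DefFun_rename _ _ (co_prod cE cF) cE _ (lshift _)) => z i; rewrite cofK. Qed.

Lemma DefFun_snd0 {E F} {cE : co M E} {cF : co M F} : DefFun S (fun x : E * F => x.2).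
Proof. by apply: (@DefFun_rename _ _ (co_prod cE cF) cF _ (@rshift _ _)) => z i; rewrite cofK. Qed.

Lemma Def_comp {E F} {cE : co M E} {cF : co M F} (P : F -> Prop) (g : E -> F) :
  Def S P -> DefFun S g -> Def S (fun x => P (g x)).
Proof.
move=> hP hg.
have h2 : Def S (fun p : E * F => P p.2).
  by apply: (@Def_rename _ _ (co_prod cE cF) cF (fun p => p.2) (@rshift _ _)) hP => z i; rewrite cofK.
apply: Def_ext (@Def_ex _ _ _ _ (fun x y => g x = y /\ P y) (Def_and hg h2)) => x.
by split=> [[y [<-]]|h]; last by exists (g x).
Qed.

Lemma DefFun_comp {E F G} {cE : co M E} {cF : co M F} {cG : co M G} (f : F -> G) (g : E -> F) :
  DefFun S f -> DefFun S g -> DefFun S (fun x => f (g x)).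
Proof.
move=> hf hg.
have hg1 : Def S (fun p : (E * G) * F => g p.1.1 = p.2).
  apply: (@Def_rename _ _ (co_prod (co_prod cE cG) cF) (co_prod cE cF) (fun p => (p.1.1, p.2))
    (osum (fun a => lshift _ (lshift _ a)) (fun b => rshift _ b))) hg => z i /=.
  by rewrite /osum /catp; case: (fintype.split i) => a; rewrite cofK.
have hf1 : Def S (fun p : (E * G) * F => f p.2 = p.1.2).
  apply: (@Def_rename _ _ (co_prod (co_prod cE cG) cF) (co_prod cF cG) (fun p => (p.2, p.1.2))
    (osum (fun a => rshift _ a) (fun b => lshift _ (rshift _ b)))) hf => z i /=.
  by rewrite /osum /catp; case: (fintype.split i) => a; rewrite cofK.
have h := @Def_ex _ _ _ _ (fun (p : E * G) y => g p.1 = y /\ f y = p.2) (Def_and hg1 hf1).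
by apply: Def_ext h => p; split=> [[y [<-]]|h]; last by exists (g p.1).
Qed.

Lemma DefFun_fst {E F G} {cE : co M E} {cF : co M F} {cG : co M G} (g : E -> F * G) :
  DefFun S g -> DefFun S (fun x => (g x).1).
Proof. exact: (DefFun_comp DefFun_fst0). Qed.

Lemma DefFun_snd {E F G} {cE : co M E} {cF : co M F} {cG : co M G} (g : E -> F * G) :
  DefFun S g -> DefFun S (fun x => (g x).2).
Proof. exact: (DefFun_comp DefFun_snd0). Qed.

Lemma DefFun_pair {E F G} {cE : co M E} {cF : co M F} {cG : co M G} (f : E -> F) (g : E -> G) :
  DefFun S f -> DefFun S g -> DefFun S (fun x => (f x, g x)).
Proof.
move=> hf hg.
have h1 : Def S (fun p : E * (F * G) => f p.1 = p.2.1).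
  apply: (@Def_rename _ _ (co_prod cE (co_prod cF cG)) (co_prod cE cF) (fun p => (p.1, p.2.1))
    (osum (fun a => lshift _ a) (fun b => rshift _ (lshift _ b)))) hf => z i /=.
  by rewrite /osum /catp; case: (fintype.split i) => a; rewrite cofK.
have h2 : Def S (fun p : E * (F * G) => g p.1 = p.2.2).
  apply: (@Def_rename _ _ (co_prod cE (co_prod cF cG)) (co_prod cE cG) (fun p => (p.1, p.2.2))
    (osum (fun a => lshift _ a) (fun b => rshift _ (rshift _ b)))) hg => z i /=.
  by rewrite /osum /catp; case: (fintype.split i) => a; rewrite cofK.
apply: Def_ext (Def_and h1 h2) => -[x [y z]] /=.
by split=> [[-> ->]|[-> ->]].
Qed.

Lemma Def_comp2 {E F G} {cE : co M E} {cF : co M F} {cG : co M G} (P : F -> G -> Prop)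
    (f : E -> F) (g : E -> G) :
  Def S (fun p : F * G => P p.1 p.2) -> DefFun S f -> DefFun S g ->
  Def S (fun x => P (f x) (g x)).
Proof.
move=> hP hf hg.
exact: (@Def_comp _ _ _ _ (fun p : F * G => P p.1 p.2) _ hP (DefFun_pair hf hg)).
Qed.

Lemma DefFun_comp2 {E F G K} {cE : co M E} {cF : co M F} {cG : co M G} {cK : co M K}
    (h : F -> G -> K) (f : E -> F) (g : E -> G) :
  DefFun S (fun p : F * G => h p.1 p.2) -> DefFun S f -> DefFun S g ->
  DefFun S (fun x => h (f x) (g x)).
Proof.
move=> hh hf hg.
exact: (@DefFun_comp _ _ _ _ _ _ (fun p : F * G => h p.1 p.2) _ hh (DefFun_pair hf hg)).
Qed.

Lemma Def_eq {E F} {cE : co M E} {cF : co M F} (f g : E -> F) :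
  DefFun S f -> DefFun S g -> Def S (fun x => f x = g x).
Proof. by move=> hf hg; apply: (Def_comp2 (P := fun y z => y = z) Def_diag hf hg). Qed.

Lemma DefFun_coord {E n} {cE : co M E} (g : E -> pt M n) (i : 'I_n) :
  DefFun S g -> DefFun S (fun x => g x i).
Proof.
apply: (@DefFun_comp _ _ _ _ _ _ (fun y : pt M n => y i)).
by apply: (@DefFun_rename _ _ (co_pt M n) (co_base M) _ (fun=> i)) => z j.
Qed.

Lemma DefFun_vec {E n} {cE : co M E} (g : E -> pt M n) :
  (forall i, DefFun S (fun x => g x i)) -> DefFun S g.
Proof.
move=> hg; have h : Def S (fun p : E * pt M n => forall i, g p.1 i = p.2 i).
  apply: Def_fall => i; apply: Def_eq; last exact: DefFun_coord DefFun_snd0.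
  exact: (@DefFun_comp _ _ _ _ _ _ (fun x => g x i)) DefFun_fst0.
apply: Def_ext h => -[x y] /=; split=> [h|<- //].
exact: functional_extensionality.
Qed.

Lemma Def_point {E} {cE : co M E} (c : E) : Def S (fun x => x = c).
Proof.
have h : Def S (fun x : E => forall i, cto x i = cto c i).
  apply: Def_fall => i.
  apply: (@Def_rename _ _ cE (co_base M) (fun x => cto x i) (fun=> i) (fun a => a = cto c i)).
    by move=> z j; rewrite cofK.
  exact: (st_point HS).
apply: Def_ext h => x; split=> [h|-> //].
by rewrite -(ctoK x) -(ctoK c); congr cof; apply: functional_extensionality.
Qed.

Lemma DefFun_const {E F} {cE : co M E} {cF : co M F} (c : F) : DefFun S (fun _ : E => c).
Proof.
apply: Def_ext (@Def_comp (E * F) F _ _ _ (fun p => p.2) (Def_point c) DefFun_snd0) => p.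
by split=> ->.
Qed.

Lemma DefFun_cto {E} {cE : co M E} : DefFun S (fun x : E => cto x).
Proof. by apply: (@DefFun_rename _ _ cE (co_pt M (cd E)) _ id) => z i; rewrite cofK. Qed.

Lemma DefFun_cof {E} {cE : co M E} : DefFun S (fun x : pt M (cd E) => cof x : E).
Proof. by apply: (@DefFun_rename _ _ (co_pt M (cd E)) cE _ id) => z i; rewrite cofK. Qed.
End Definability.

(** Structural proof of definability; atoms are looked up among the hypotheses. *)
Ltac ddef_step HS :=
  cbv beta;
  match goal with
  | H : Def ?S ?P |- Def ?S ?P => exact H
  | |- Def _ (fun _ => ?A) => apply (Def_prop HS)
  | |- Def _ (fun x => ~ _) => apply (Def_not HS)
  | |- Def _ (fun x => _ /\ _) => apply (Def_and HS)
  | |- Def _ (fun x => _ \/ _) => apply (Def_or HS)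
  | |- Def _ (fun x => _ <-> _) => unfold iff
  | |- Def _ (fun x => exists i : ordinal _, _) => apply (Def_fex HS); intro
  | |- Def _ (fun x => exists _, _) => apply (Def_ex HS)
  | |- Def _ (fun x => _ = _) => apply (Def_eq HS)
  | H : Def ?S ?P |- Def ?S (fun x => ?P (@?g x)) => apply (Def_comp HS H)
  | H : Def ?S (fun p => ?P (fst p) (snd p)) |- Def ?S (fun x => ?P (@?f x) (@?g x)) =>
      apply (Def_comp2 HS (P := P) H)
  | |- Def _ (fun x => forall i : ordinal _, _) => apply (Def_fall HS); intro
  | |- Def _ (fun x => _ -> _) => apply (Def_imp HS)
  | |- Def _ (fun x => forall _, _) => apply (Def_all HS)
  | H : DefFun ?S ?f |- DefFun ?S ?f => exact H
  | |- DefFun _ (fun x => x) => apply (DefFun_id HS)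
  | |- DefFun _ fst => apply (DefFun_fst0 HS)
  | |- DefFun _ snd => apply (DefFun_snd0 HS)
  | |- DefFun _ cto => apply (DefFun_cto HS)
  | |- DefFun _ cof => apply (DefFun_cof HS)
  | |- DefFun _ (fun _ => ?c) => apply (DefFun_const HS)
  | |- DefFun _ (fun x => (_, _)) => apply (DefFun_pair HS)
  | |- DefFun _ (fun x => fst _) => apply (DefFun_fst HS)
  | |- DefFun _ (fun x => snd _) => apply (DefFun_snd HS)
  | |- DefFun _ (fun x => cto _) => apply (DefFun_comp HS (DefFun_cto HS))
  | |- DefFun _ (fun x => cof _) => apply (DefFun_comp HS (DefFun_cof HS))
  | |- @DefFun ?M ?S ?E ?F ?cE ?cF ?f =>
      lazymatch f with (fun _ => _) => fail | _ => idtac end;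
      change (@DefFun M S E F cE cF (fun x : E => f x))
  | H : DefFun ?S ?f |- DefFun ?S (fun x => ?f (@?g x)) => apply (DefFun_comp HS H)
  | H : DefFun ?S (fun p => ?f (fst p) (snd p)) |- DefFun ?S (fun x => ?f (@?g x) (@?h x)) =>
      apply (DefFun_comp2 HS (h := f) H)
  | |- @DefFun _ _ ?E _ _ _ ?f =>
      let g := constr:(fun x : E => ltac:(
        let t := eval cbv beta in (f x) in match t with ?h _ => exact h end)) in
      apply (DefFun_coord HS (g := g))
  | |- DefFun _ (fun x => (fun i : ordinal _ => _)) => apply (DefFun_vec HS); intro
  end.

Ltac ddef :=
  repeat match goal with
  | HS : is_structure ?S |- Def ?S _ => ddef_step HS
  | HS : is_structure ?S |- DefFun ?S _ => ddef_step HS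
  end.

(** * Definable maps obtained from definable relations *)

Section DefinableFunctions.
Variables (M : Type) (S : dsys M).
Hypothesis HS : is_structure S.

Lemma DefFun_of_graph {E F} {cE : co M E} {cF : co M F} (R : E -> F -> Prop) :
  Def S (fun p : E * F => R p.1 p.2) ->
  (forall x, exists y, R x y) -> (forall x y y', R x y -> R x y' -> y = y') ->
  exists f : E -> F, DefFun S f /\ forall x, R x (f x).
Proof.
move=> hR ex un.
exists (fun x => proj1_sig (constructive_indefinite_description _ (ex x))).
have h x := proj2_sig (constructive_indefinite_description _ (ex x)).
split=> //; apply: (Def_ext HS) hR => -[x y] /=; split=> [hxy|<- //].
exact: un (h x) hxy.
Qed.

(** Where the relation has no witness the map takes the default value [y0], which keeps it total and
    definable. *)
Lemma DefFun_partial {E F} {cE : co M E} {cF : co M F} (R : E -> F -> Prop) (y0 : F) :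
  Def S (fun p : E * F => R p.1 p.2) -> (forall x y y', R x y -> R x y' -> y = y') ->
  exists f : E -> F, DefFun S f /\ forall x y, R x y -> f x = y.
Proof.
move=> hR un.
have [||x|f [hf fP]] := @DefFun_of_graph E F _ _
  (fun x y => R x y \/ (~ (exists y, R x y)) /\ y = y0).
- by ddef.
- move=> x; case: (classic (exists y, R x y)) => [[y h]|h]; first by exists y; left.
  by exists y0; right.
- move=> y y' [h1|[h1 ->]] [h2|[h2 ->]] //; first exact: un h1 h2.
    by case: h2; exists y.
  by case: h1; exists y'.
exists f; split=> // x y hxy; case: (fP x) => [h|[[]]]; last by exists y.
exact: un h hxy.
Qed.

Lemma DefFun_if {E F} {cE : co M E} {cF : co M F} (P : E -> Prop) (f g : E -> F) :
  Def S P -> DefFun S f -> DefFun S g ->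
  exists h : E -> F, DefFun S h /\ (forall x, P x -> h x = f x) /\ (forall x, ~ P x -> h x = g x).
Proof.
move=> hP hf hg.
have [||x|h [hh hE]] := @DefFun_of_graph E F _ _
  (fun x y => P x /\ f x = y \/ ~ P x /\ g x = y).
- by ddef.
- by move=> x; case: (classic (P x)) => h; [exists (f x); left | exists (g x); right].
- by move=> y y' [[h1 <-]|[h1 <-]] [[h2 <-]|[h2 <-]].
by exists h; split=> //; split=> x hx; case: (hE x) => [[]|[]].
Qed.
End DefinableFunctions.

(** * Dimension *)

Lemma pred_ext (T : Type) (P Q : T -> Prop) : (forall x, P x <-> Q x) -> P = Q.
Proof.
by move=> h; apply: functional_extensionality => x; apply: propositional_extensionality.
Qed.

Section Dimension.
Variables (M : Type) (lt : M -> M -> Prop) (SM SN : dsys M).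
Variable dim : forall n, pset M n -> option nat.
Hypothesis Hlt : dlo lt.
Hypothesis Hom : ominimal lt SM.
Hypothesis HN : is_structure SN.
Hypothesis HMN : forall n (A : pset M n), @SM n A -> @SN n A.
Hypothesis Hd : dim_fun lt SM SN dim.

Definition dimE E {cE : co M E} (P : E -> Prop) := @dim (cd E) (fun z => P (cof z)).

Section Basic.
Context {E F : Type} {cE : co M E} {cF : co M F}.

Lemma dimE_ext (P Q : E -> Prop) : (forall x, P x <-> Q x) -> dimE P = dimE Q.
Proof. by move=> h; rewrite (pred_ext h). Qed.

Lemma dimE_bij (P : E -> Prop) (Q : F -> Prop) (f : E -> F) :
  Def SN P -> Def SN Q -> DefFun SN f ->
  (forall x, P x -> Q (f x)) -> (forall x x', P x -> P x' -> f x = f x' -> x = x') ->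
  (forall y, Q y -> exists x, P x /\ f x = y) -> dimE P = dimE Q.
Proof.
move=> hP hQ hf h1 h2 h3.
apply: (D4 Hd (f := fun z => cto (f (cof z))) hP hQ).
- have h : Def SN (fun p : E * F => P p.1 /\ f p.1 = p.2) by ddef.
  apply: (st_ext HN) h => z /=; split=> [[h ->]|[h e]]; first by rewrite cofK.
  by rewrite -e ctoK.
- by move=> z hz; rewrite ctoK; apply: h1.
- move=> z z' hz hz' e; rewrite -(cofK z) -(cofK z'); congr cto; apply: h2 => //.
  by rewrite -(ctoK (f (cof z))) e ctoK.
- move=> y hy; have [x [hx e]] := h3 _ hy; exists (cto x); rewrite ctoK; split=> //.
  by rewrite e cofK.
Qed.

Lemma Def_slice S (P : E -> F -> Prop) x : is_structure S ->
  Def S (fun p : E * F => P p.1 p.2) -> Def S (P x).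
Proof. by move=> HS hP; have h : Def S (fun y => P x y) by ddef. Qed.

Lemma dimE_mono (P Q : E -> Prop) k : Def SN P -> Def SN Q ->
  (forall x, P x -> Q x) -> dlt (dimE Q) k -> dlt (dimE P) k.
Proof.
move=> hP hQ h.
have hD : Def SN (fun x => Q x /\ ~ P x) by ddef.
have e : dimE Q = dmax (dimE P) (dimE (fun x => Q x /\ ~ P x)).
  rewrite -(D2 Hd hP hD); apply: (@dimE_ext Q (fun x => P x \/ (Q x /\ ~ P x))) => x.
  split=> [hx|[|[]//]]; last exact: h.
  by case: (classic (P x)); [left | right].
rewrite e; case: (dimE P) (dimE (fun x => Q x /\ ~ P x)) => [a|] [b|] //=.
by rewrite gtn_max => /andP[].
Qed.
End Basic.

(** (D3b) asks for pairwise disjoint sets, so each fibre [P x] is replaced by its copy over [x] in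
    the product, which has the same dimension by (D4). *)
Lemma dimE_fib {E F} {cE : co M E} {cF : co M F} (P : E -> F -> Prop) (I : E -> Prop) d :
  Def SN (fun p : E * F => P p.1 p.2) -> Def SN I ->
  (forall x, I x -> dimE (P x) = d) ->
  dimE (fun p : E * F => I p.1 /\ P p.1 p.2) = dadd (dimE I) d.
Proof.
move=> hP hI hd.
have hZ : Def SN (fun q : E * (E * F) => q.1 = q.2.1 /\ P q.2.1 q.2.2) by ddef.
pose Z (w : pt M (@cd M E cE + (@cd M E cE + @cd M F cF))) :=
  @cof M E cE (lpart w) = @cof M E cE (lpart (rpart w)) /\
  P (@cof M E cE (lpart (rpart w))) (@cof M F cF (rpart (rpart w))).
have fE (t : pt M (cd E)) : fiber Z t =
   (fun z => cof t = cof (lpart z) /\ P (cof (lpart z)) (cof (rpart z))).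
  by apply: functional_extensionality => z; rewrite /fiber /Z !lpart_catp !rpart_catp.
rewrite -(D3b Hd (k := d) (Z := Z) hI hZ).
- rewrite /dimE; congr (dim _); apply: pred_ext => z /=; split.
    by case=> h1 h2; exists (lpart z); rewrite fE.
  by case=> t [ht]; rewrite fE => -[e1 e2]; rewrite -e1 in e2 *.
- move=> t t' x _ _ ne; rewrite !fE => -[e1 _] [e2 _]; apply: ne.
  by rewrite -(cofK t) -(cofK t') e1 e2.
- move=> t ht; rewrite fE -(hd _ ht) /=; symmetry.
  apply: (dimE_bij (Q := fun q : E * F => cof t = q.1 /\ P q.1 q.2) (f := fun y => (cof t, y))).
  + exact: Def_slice.
  + by ddef.
  + by ddef.
  + by [].
  + by move=> y y' _ _ [].
  + by move=> [x y] /= [<- h]; exists y.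
Qed.

Lemma Def_dimE {E F} {cE : co M E} {cF : co M F} (P : E -> F -> Prop) d :
  Def SN (fun p : E * F => P p.1 p.2) -> Def SN (fun x => dimE (P x) = d).
Proof.
move=> hP; have hI : Def SN (fun _ : E => True) by ddef.
apply: (st_ext HN) (D3a Hd hI hP d) => t.
rewrite /=.
have -> : fiber (fun z : pt M (cd E + cd F) => P (cof (lpart z)) (cof (rpart z))) t =
    (fun z => P (cof t) (cof z)).
  by apply: functional_extensionality => z; rewrite /fiber /= lpart_catp rpart_catp.
by split=> [[]|].
Qed.

Lemma dimE_point {E} {cE : co M E} (c : E) : dimE (fun x => x = c) = Some 0.
Proof.
have [a0 _] : exists a : M, True.
  apply: NNPP => h; have : @dim 1 (fun _ => True) = None.
    by apply/(D1_empty Hd) => [|x _]; [exact: (@Def_prop M SN HN M (co_base M) True) |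
      apply: h; exists (x ord0)].
  by rewrite (D1_line Hd).
rewrite -(D1_point Hd a0); symmetry.
apply: (dimE_bij (P := fun x : M => x = a0) (f := fun=> c)).
- by ddef.
- by ddef.
- by ddef.
- by [].
- by move=> x x' -> ->.
- by move=> y ->; exists a0.
Qed.

(** (D5) for the whole space. It leaves finitely many possible dimensions for the fibres of a
    family, so that arguments can split by that dimension. *)
Lemma dimE_bound {E} {cE : co M E} (P : E -> Prop) : Def SN P -> dlt (dimE P) (cd E).+1.
Proof.
move=> hP; have hT : Def SN (fun _ : E => True) by ddef.
apply: (dimE_mono hP hT) => //.
have hT' : Def SM (fun _ : E => True) by exact: (Def_prop Hom.1).
have := D5 Hd hT'.
rewrite -/(dimE (fun=> True)); case: (dimE _) => [k [[s [si _]] _]|//] /=.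
by have := leq_card s si; rewrite !card_ord ltnS.
Qed.

(** [sm k P] says that [P] lies in a definable set of dimension less than [k];
    the outer form makes it monotone without definability side conditions. *)
Definition sm k E {cE : co M E} (P : E -> Prop) : Prop :=
  exists Q : E -> Prop, [/\ Def SN Q, forall x, P x -> Q x & dlt (dimE Q) k].

Section Small.
Context {E : Type} {cE : co M E}.

Lemma sm_defE k (P : E -> Prop) : Def SN P -> sm k P <-> dlt (dimE P) k.
Proof.
by move=> hP; split=> [[Q [hQ s]]|h]; [apply: dimE_mono | exists P; split].
Qed.

Lemma sm_mono k (P Q : E -> Prop) : (forall x, P x -> Q x) -> sm k Q -> sm k P.
Proof. by move=> h [Q' [? s ?]]; exists Q'; split=> // x /h /s. Qed.

Lemma sm_le k l (P : E -> Prop) : k <= l -> sm k P -> sm l P.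
Proof.
move=> h [Q [? ? hd]]; exists Q; split=> //; move: hd; case: (dimE Q) => //= d hd.
exact: leq_trans hd h.
Qed.

Lemma sm_or k (P Q : E -> Prop) : sm k P -> sm k Q -> sm k (fun x => P x \/ Q x).
Proof.
move=> [P' [hP sP dP]] [Q' [hQ sQ dQ]]; exists (fun x => P' x \/ Q' x).
split; first by ddef.
- by move=> x [/sP|/sQ]; [left | right].
rewrite /dimE (D2 Hd hP hQ) -!/(dimE _); move: dP dQ.
by case: (dimE P') (dimE Q') => [a|] [b|] //=; rewrite gtn_max => -> ->.
Qed.

Lemma sm_empty k (P : E -> Prop) : (forall x, ~ P x) -> sm k P.
Proof.
move=> h; exists (fun _ => False); split; [by ddef | by move=> x /h |].
have -> : dimE (fun _ : E => False) = None; last by [].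
by apply/(D1_empty Hd) => [|x []]; exact: (st_empty HN).
Qed.

Lemma sm_zero (P : E -> Prop) : sm 0 P -> forall x, ~ P x.
Proof.
move=> [Q [hQ s hd]] x /s hx.
have e : dimE Q = None by case: (dimE Q) hd.
have h := proj1 (D1_empty Hd hQ) e (cto x).
by apply: h; rewrite ctoK.
Qed.

Lemma sm_fUn (I : finType) k (P : I -> E -> Prop) :
  (forall i, sm k (P i)) -> sm k (fun x => exists i, P i x).
Proof.
move=> h.
have hs : forall s : seq I, sm k (fun x => exists2 i, i \in s & P i x).
  elim=> [|j s IH]; first by apply: sm_empty => x [].
  apply: sm_mono (sm_or (h j) IH) => x [i]; rewrite inE => /orP[/eqP->|hi hx]; first by left.
  by right; exists i.
by apply: sm_mono (hs (enum I)) => x [i hi]; exists i; rewrite ?mem_enum.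
Qed.

Lemma sm_sub1 (P : E -> Prop) : (forall x x', P x -> P x' -> x = x') -> sm 1 P.
Proof.
move=> h; case: (classic (exists c, P c)) => [[c hc]|h0]; last first.
  by apply: sm_empty => x hx; apply: h0; exists x.
exists (fun x => x = c); split; [by ddef | by move=> x hx; apply: h |].
by rewrite dimE_point.
Qed.
End Small.

Section SmallDefinable.
Context {E F : Type} {cE : co M E} {cF : co M F}.

(** Smallness is a finite disjunction over the values of the dimension, and each value is a
    definable condition by (D3a). *)
Lemma Def_sm k (P : E -> F -> Prop) :
  Def SN (fun p : E * F => P p.1 p.2) -> Def SN (fun x => sm k (P x)).
Proof.
move=> hP.
have h : Def SN (fun x => dimE (P x) = None \/ exists d : 'I_k, dimE (P x) = Some (val d)).
  by apply: (Def_or HN); [|apply: (Def_fex HN) => d]; exact: Def_dimE.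
apply: (Def_ext HN) h => x; have hx : Def SN (P x) by exact: Def_slice.
split=> [hd|/(sm_defE k hx)]; first by apply/(sm_defE k hx); case: hd => [->|[d ->]] /=.
by case: (dimE (P x)) => [d /= hd|]; [right; exists (Ordinal hd) | left].
Qed.

Lemma sm_swap n (P : E -> F -> Prop) :
  sm n (fun p : E * F => P p.1 p.2) -> sm n (fun p : F * E => P p.2 p.1).
Proof.
move=> [Q [hQ s hd]]; exists (fun p => Q (p.2, p.1)); split; first by ddef.
  by move=> [y x] /= h; apply: s.
have <- // : dimE Q = dimE (fun p : F * E => Q (p.2, p.1)).
apply: (dimE_bij (f := fun p => (p.2, p.1))) => //; [by ddef | by ddef | by case | | ].
- by move=> [a b] [a' b'] _ _ [-> ->].
- by move=> [y x] h; exists (x, y).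
Qed.

Lemma sm_cof k (P : E -> Prop) : Def SN P ->
  sm k P <-> sm k (fun z : pt M (cd E) => P (cof z)).
Proof.
move=> hP; have hP' : Def SN (fun z : pt M (cd E) => P (cof z)) by exact: hP.
split=> h.
  by apply/(sm_defE _ hP'); move/(sm_defE _ hP): h.
by apply/(sm_defE _ hP); move/(sm_defE _ hP'): h.
Qed.
End SmallDefinable.

(** * Additivity of dimension in terms of small sets *)

Section Fubini.
Context {E F : Type} {cE : co M E} {cF : co M F}.

(** Sort the fibres by dimension [d]. For [l <= d] the base of those fibres has dimension [a] with
    [a + d < n], hence [a < n - l]; finitely many [d] occur. *)
Lemma sm_fiber n l (P : E -> F -> Prop) : l <= n ->
  sm n (fun p : E * F => P p.1 p.2) -> sm (n - l) (fun x => ~ sm l (P x)).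
Proof.
move=> ln [Q0 [hQ0 s hd]]; pose Q x y := Q0 (x, y).
have hQ : Def SN (fun p : E * F => Q p.1 p.2) by rewrite /Q; ddef.
have {}hd : dlt (dimE (fun p : E * F => Q p.1 p.2)) n.
  by rewrite (@dimE_ext _ _ _ Q0) // => -[].
have h (d : 'I_(cd F).+1) : sm (n - l) (fun x => l <= d /\ dimE (Q x) = Some (val d)).
  case: (leqP l d) => [ld|_]; last by apply: sm_empty => x [].
  have hX := @Def_dimE _ _ _ _ Q (Some (val d)) hQ.
  apply: (@sm_mono _ _ _ _ (fun x => dimE (Q x) = Some (val d))) => [x []//|].
  apply/(sm_defE _ hX).
  have := @dimE_fib _ _ _ _ Q _ (Some (val d)) hQ hX (fun x h => h).
  have hI : Def SN (fun p : E * F => dimE (Q p.1) = Some (val d) /\ Q p.1 p.2).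
    by apply: (Def_and HN) hQ; apply: (Def_comp HN hX); ddef.
  have := dimE_mono hI hQ (fun p => @proj2 _ _) hd.
  move=> h1 h2; move: h1; rewrite h2; case: (dimE _) => //= a ha.
  by rewrite ltn_subRL addnC; apply: leq_ltn_trans ha; rewrite leq_add2l.
apply: sm_mono (sm_fUn h) => x hx.
have hQx : Def SN (Q x) by exact: Def_slice.
have := dimE_bound hQx; case e : (dimE (Q x)) => [d|] /= hb.
  exists (Ordinal hb); split=> //=; rewrite leqNgt; apply/negP => dl; apply: hx.
  apply: (@sm_mono _ _ _ _ (Q x)) => [y hy|]; first exact: (s (x, y)).
  by apply/(sm_defE _ hQx); rewrite e.
case: hx; apply: (@sm_mono _ _ _ _ (Q x)) => [y hy|]; first exact: (s (x, y)).
by apply/(sm_defE _ hQx); rewrite e.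
Qed.

(** Converse of [sm_fiber]: the part of the total set over fibres of dimension [d] is bounded by the
    hypothesis at [l = d]. *)
Lemma sm_total n (P : E -> F -> Prop) : Def SN (fun p : E * F => P p.1 p.2) ->
  (forall l, l <= n -> sm (n - l) (fun x => ~ sm l (P x))) ->
  sm n (fun p : E * F => P p.1 p.2).
Proof.
move=> hP h.
have hs (d : 'I_(cd F).+1) : sm n (fun p : E * F => dimE (P p.1) = Some (val d) /\ P p.1 p.2).
  have hX := @Def_dimE _ _ _ _ P (Some (val d)) hP.
  have hI : Def SN (fun p : E * F => dimE (P p.1) = Some (val d) /\ P p.1 p.2).
    by apply: (Def_and HN) hP; apply: (Def_comp HN hX); ddef.
  apply/(sm_defE _ hI); rewrite (dimE_fib hP hX (fun x h => h)).
  have hx l : l <= d -> forall x, dimE (P x) = Some (val d) -> ~ sm l (P x).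
    by move=> ld x e /(sm_defE _ (Def_slice x HN hP)); rewrite e /= ltnNge ld.
  case: (leqP d n) => dn.
    have /(sm_defE _ hX) := @sm_mono _ _ (n - d) (fun x => dimE (P x) = Some (val d)) _
      (hx d (leqnn _)) (h d dn).
    by case: (dimE _) => //= a; rewrite ltn_subRL addnC.
  (* Here [d > n]: the hypothesis at [l = n] makes the base [sm 0], hence empty. *)
  have := h n (leqnn _); rewrite subnn => /(@sm_mono _ _ _ (fun x => dimE (P x) = Some (val d))).
  by move=> /(_ (hx n (ltnW dn))) /(sm_defE _ hX); case: (dimE _).
apply: sm_mono (sm_fUn hs) => -[x y] /= hxy.
have hPx : Def SN (P x) by exact: Def_slice.
have := dimE_bound hPx; case e : (dimE (P x)) => [d|] /= hb; first by exists (Ordinal hb).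
have h0 : sm 0 (P x) by apply/(sm_defE _ hPx); rewrite e.
by case: (sm_zero h0 hxy).
Qed.
End Fubini.

(** A correspondence with values of dimension at most zero does not raise dimension: its graph over
    [P] is small by [sm_total], and [sm_fiber] with [l = 0] projects it to the other side. *)
Lemma sm_corr {E F} {cE : co M E} {cF : co M F} n (R : E -> F -> Prop) (P : E -> Prop) :
  Def SN (fun p : E * F => R p.1 p.2) -> (forall x, sm 1 (R x)) -> sm n P ->
  sm n (fun y => exists x, P x /\ R x y).
Proof.
move=> hR h1 [Q [hQ s hd]].
have sQ : sm n Q by apply/(sm_defE _ hQ).
have hQR : Def SN (fun p : E * F => Q p.1 /\ R p.1 p.2) by ddef.
have h : sm n (fun p : E * F => Q p.1 /\ R p.1 p.2).
  apply: (sm_total (P := fun x y => Q x /\ R x y)) => // l ln; case: l ln => [|l] ln.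
    rewrite subn0; apply: sm_mono sQ => x hx; apply: NNPP => hq; apply: hx.
    by apply: sm_empty => y [].
  apply: sm_empty => x []; apply: (@sm_le _ _ 1) => //; apply: sm_mono (h1 x) => y [] //.
have := sm_fiber (P := fun y x => Q x /\ R x y) (leq0n n)
  (sm_swap (P := fun x y => Q x /\ R x y) h); rewrite subn0.
apply: sm_mono => y [x [hx hr]] /sm_zero; apply; split; [exact: s hx | exact: hr].
Qed.

Lemma sm_image {E F} {cE : co M E} {cF : co M F} n (f : E -> F) (P : E -> Prop) :
  DefFun SN f -> sm n P -> sm n (fun y => exists x, P x /\ f x = y).
Proof.
move=> hf; apply: (sm_corr (R := fun x y => f x = y)) => // x.
by apply: sm_sub1 => y y' -> ->.
Qed.

(** * Smallness of L-definable sets through interiors of projections *)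

Let HM : is_structure SM := Hom.1.

Let Mlt : Def SM (fun p : M * M => lt p.1 p.2).
Proof.
pose r (j : 'I_2) : 'I_(1 + 1) := if j == ord0 then lshift _ ord0 else rshift _ ord0.
by apply: (st_ext HM) (st_pullback HM r Hom.2.1) => z; rewrite /r.
Qed.

Lemma Def_SN {E} {cE : co M E} (P : E -> Prop) : Def SM P -> Def SN P.
Proof. exact: HMN. Qed.

Let Nlt : Def SN (fun p : M * M => lt p.1 p.2) := Def_SN Mlt.

Lemma has_interior_nonempty n (X : pset M n) : has_interior lt X -> exists x, X x.
Proof. by move=> [a [b [x [hx h]]]]; exists x; apply: h. Qed.

(** By (D5) the abstract dimension of an L-definable set is the o-minimal one, which only speaks of
    boxes in coordinate projections. *)
Lemma sm_interior n l (X : pt M n -> Prop) : Def SM X ->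
  sm l X <-> forall k (s : 'I_k -> 'I_n), injective s -> has_interior lt (cproj s X) -> k < l.
Proof.
move=> hX; have hXN := Def_SN hX; have := D5 Hd hX.
have -> : @dim (cd (pt M n)) (fun z => X (cof z)) = dimE X by [].
move=> hd; split.
  move=> /(sm_defE _ hXN); case: (dimE X) hd => [d [_ h] /= dl k s si hi|h _ k s si].
    exact: leq_ltn_trans (h _ _ si hi) dl.
  by move=> /has_interior_nonempty [y [x [hx _]]]; case: (h x).
move=> h; apply/(sm_defE _ hXN); case: (dimE X) hd => [d [[s [si hi]] _]|//] /=.
exact: h si hi.
Qed.

Lemma not_sm_of_interior n (X : pt M n -> Prop) : Def SM X -> has_interior lt X -> ~ sm n X.
Proof.
move=> hX hi /(sm_interior _ hX) /(_ n id (fun x y e => e)); rewrite ltnn => h.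
suff // : false by []; apply: h; have [a [b [x [hx h]]]] := hi.
by exists a, b, x; split=> // y /h hy; exists y.
Qed.

(** A projection to at least [n] of the [n] coordinates is a permutation of them, so a box in the
    projection comes from a box in [X]. *)
Lemma sm_of_no_interior n (X : pt M n -> Prop) : Def SM X -> ~ has_interior lt X -> sm n X.
Proof.
move=> hX hi; apply/(sm_interior _ hX) => k s si hs; rewrite ltnNge; apply/negP => nk.
have kn : k <= n by have := leq_card s si; rewrite !card_ord.
have e : k = n by apply/eqP; rewrite eqn_leq kn nk.
subst k; have [g sK gK] := injF_bij si.
apply: hi; have [a [b [x [hx h]]]] := hs.
exists (fun i => a (g i)), (fun i => b (g i)), (fun i => x (g i)); split=> [i|z hz].
  exact: hx.
have [|x0 [hx0 e]] := h (fun i => z (s i)).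
  by move=> i; have := hz (s i); rewrite sK.
suff -> : z = x0 by [].
by apply: functional_extensionality => i; rewrite -(gK i) e.
Qed.

(** Although [sm] quantifies over all definable sets, [sm_interior] rewrites it as a first-order
    condition on boxes over finitely many coordinate projections. This is what makes germs and
    generic values L-definable later. *)
Lemma Def_SM_sm {E F} {cE : co M E} {cF : co M F} l (P : E -> F -> Prop) :
  Def SM (fun p : E * F => P p.1 p.2) -> Def SM (fun x => sm l (P x)).
Proof.
move=> hP.
have h : Def SM (fun x => forall k : 'I_(@cd M F cF).+1, forall s : {ffun 'I_k -> 'I_(@cd M F cF)},
    injective s -> has_interior lt (cproj s (fun z => P x (cof z))) -> k < l).
  apply: (Def_fall HM) => k; apply: (Def_fall HM) => s.
  by rewrite /has_interior /cproj /box; ddef.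
apply: (Def_ext HM) h => x.
have hx : Def SM (P x) by exact: Def_slice.
have hx' : Def SM (fun z : pt M (cd F) => P x (cof z)) by exact: hx.
split=> [h|].
  apply/(sm_cof _ (Def_SN hx))/(sm_interior _ hx') => k s si hs.
  have kn : k < (@cd M F cF).+1 by have := leq_card s si; rewrite !card_ord.
  have e : finfun s = s :> (_ -> _) by apply: functional_extensionality => i; rewrite ffunE.
  by apply: (h (Ordinal kn) (finfun s)); rewrite e.
by move=> /(sm_cof _ (Def_SN hx))/(sm_interior _ hx') h k s; apply: h.
Qed.

(** * One-sided behaviour of L-definable subsets of the line *)

Lemma lt_min c d d' : lt c d -> lt c d' ->
  exists2 e, lt c e & forall y, lt y e -> lt y d /\ lt y d'.
Proof.
move=> h h'; case: (lt_total Hlt d d') => [dd'|[<-|dd']].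
- by exists d => // y hy; split=> //; apply: (lt_trans Hlt) dd'.
- by exists d.
- by exists d' => // y hy; split=> //; apply: (lt_trans Hlt) dd'.
Qed.

(** Membership in finitely many points and intervals is constant just to the right of [c]: treat
    them one at a time, shrinking the right end. *)
Lemma ominimal_right (A : M -> Prop) c : Def SM A ->
  exists2 d, lt c d & (forall y, lt c y -> lt y d -> A y) \/
                      (forall y, lt c y -> lt y d -> ~ A y).
Proof.
move=> hA; have [ps [ivs hP]] := Hom.2.2 _ hA.
have {}hP x : A x <-> List.In x ps \/ exists ab, List.In ab ivs /\ in_interval lt ab.1 ab.2 x.
  exact: (hP (fun=> x)).
have [d0 cd0 h0] : exists2 d, lt c d & forall y, lt c y -> lt y d -> ~ List.In y ps.
  elim: ps {hP} => [|p ps [d cd h]].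
    by have [d cd] := lt_nomax Hlt c; exists d => // y _ _ [].
  case: (classic (lt c p)) => [cp|ncp].
    have [e ce he] := lt_min cd cp; exists e => // y cy /he [yd yp] [e1|]; last exact: h.
    by subst y; apply: (lt_irr Hlt) yp.
  by exists d => // y cy yd [e1|]; [apply: ncp; rewrite e1 | apply: h].
have [d1 cd1 h1] : exists2 d, lt c d &
    (exists2 ab, List.In ab ivs & forall y, lt c y -> lt y d -> in_interval lt ab.1 ab.2 y) \/
    (forall y, lt c y -> lt y d -> forall ab, List.In ab ivs -> ~ in_interval lt ab.1 ab.2 y).
  elim: ivs {hP} => [|[a b] ivs [d cd h]].
    by have [d cd] := lt_nomax Hlt c; exists d => //; right=> y _ _ ab [].
  have [d2 cd2 h2] : exists2 d, lt c d &
      (forall y, lt c y -> lt y d -> in_interval lt a b y) \/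
      (forall y, lt c y -> lt y d -> ~ in_interval lt a b y).
    have [[d2 cd2 ha]|ha] :
        (exists2 d, lt c d & forall y, lt c y -> lt y d -> ~ in_interval lt a b y) \/
        (forall y, lt c y -> match a with Some a => lt a y | None => True end).
      case: a => [a|]; last by right.
      case: (lt_total Hlt a c) => [ac|[->|ca]]; [right=> y cy | by right |].
        exact: (lt_trans Hlt) ac cy.
      left; exists a => // y _ ya [/= ay _].
      exact: (lt_irr Hlt) (lt_trans Hlt ay ya).
    - by exists d2 => //; right.
    case: b => [b|]; last first.
      by have [e ce] := lt_nomax Hlt c; exists e => //; left=> y cy _; split=> //; apply: ha.
    case: (lt_total Hlt c b) => [cb|hb].
      by exists b => //; left=> y cy yb; split=> //; apply: ha.
    exists d => //; right=> y cy _ [_ /= yb]; case: hb => [e|bc].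
      by subst b; exact: (lt_irr Hlt) (lt_trans Hlt cy yb).
    exact: (lt_irr Hlt) (lt_trans Hlt bc (lt_trans Hlt cy yb)).
  have [e ce he] := lt_min cd cd2; exists e => //.
  case: h2 => h2.
    by left; exists (a, b); [left | move=> y cy /he [_ yd]; apply: h2].
  case: h => [[ab hab h]|h].
    by left; exists ab; [right | move=> y cy /he [yd _]; apply: h].
  right=> y cy /he [yd yd2] ab [<-|]; last exact: h.
  exact: h2.
have [e ce he] := lt_min cd0 cd1; exists e => //.
case: h1 => [[ab hab h]|h].
  by left=> y cy /he [_ yd]; apply/hP; right; exists ab; split=> //; apply: h.
right=> y cy /he [yd0 yd1] /hP [|[ab [h1 h2]]]; first exact: h0.
exact: (h y cy yd1 ab).
Qed.

(** * Closures of L-definable sets *)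

Lemma Def_closure S n (X : pt M n -> Prop) : is_structure S ->
  Def S (fun p : M * M => lt p.1 p.2) -> Def S X -> Def S (closure lt X).
Proof. by move=> HS hlt hX; rewrite /closure /box; ddef. Qed.

Lemma closure_sub n (X : pset M n) x : X x -> closure lt X x.
Proof. by move=> hx a b h; exists x. Qed.

(* A projection of [closure X] with interior is contained in the closure of the
   projection of [X]; a box splits into the part inside and the part outside that
   projection, and by [D2] one of the two has interior. *)
Lemma sm_closure n l (X : pt M n -> Prop) : Def SM X -> sm l X -> sm l (closure lt X).
Proof.
move=> hX sX; have hC : Def SM (closure lt X) by exact: Def_closure.
apply/(sm_interior _ hC) => k s si hi; rewrite ltnNge; apply/negP => lk.
have hY : Def SM (cproj s X) by rewrite /cproj; ddef.
have sY : sm k (cproj s X).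
  apply: sm_of_no_interior => // /(proj1 (sm_interior _ hX) sX _ _ si).
  by rewrite ltnNge lk.
have [a [b [x [hx hbox]]]] := hi.
have hB : Def SM (box lt a b) by rewrite /box; ddef.
have hBY : Def SM (fun y => box lt a b y /\ ~ cproj s X y) by rewrite /box; ddef.
have [a' [b' [x' [hx' hbox']]]] : has_interior lt (fun y => box lt a b y /\ ~ cproj s X y).
  apply: NNPP => hn; apply: (not_sm_of_interior hB); first by exists a, b, x.
  apply: sm_mono (sm_or sY (sm_of_no_interior hBY hn)) => y hy.
  by case: (classic (cproj s X y)) => h; [left | right].
have [z [hz ez]] := hbox _ (proj1 (hbox' _ hx')).
(* A box around [z] that has the sides of the small box in the coordinates hit by [s] and arbitrary
   sides elsewhere; a point of [X] in it projects into the small box. *)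
have [lo hlo] : exists lo : pt M n, forall i, lt (lo i) (z i) /\ forall j, s j = i -> lo i = a' j.
  apply: (choice (fun i y => lt y (z i) /\ forall j, s j = i -> y = a' j)) => i.
  case: (pickP (fun j => s j == i)) => [j /eqP ej|hj].
    exists (a' j); split=> [|j' ej']; last by congr a'; apply: si; rewrite ej.
    by rewrite -ej -ez; exact: (hx' j).1.
  have [y hy] := lt_nomin Hlt (z i); exists y; split=> // j ej.
  by have := hj j; rewrite ej eqxx.
have [hi' hhi] : exists hi : pt M n, forall i, lt (z i) (hi i) /\ forall j, s j = i -> hi i = b' j.
  apply: (choice (fun i y => lt (z i) y /\ forall j, s j = i -> y = b' j)) => i.
  case: (pickP (fun j => s j == i)) => [j /eqP ej|hj].
    exists (b' j); split=> [|j' ej']; last by congr b'; apply: si; rewrite ej.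
    by rewrite -ej -ez; exact: (hx' j).2.
  have [y hy] := lt_nomax Hlt (z i); exists y; split=> // j ej.
  by have := hj j; rewrite ej eqxx.
have [i|w [hw Xw]] := hz lo hi'; first by split; [exact: (hlo i).1 | exact: (hhi i).1].
have [i|_ []] := hbox' (fun j => w (s j)); last by exists w.
by have [h1 h2] := hw (s i); rewrite -((hlo _).2 i erefl) -((hhi _).2 i erefl).
Qed.

Lemma sm_dim_eq {E} {cE : co M E} (P Q : E -> Prop) : Def SN P -> Def SN Q ->
  (forall l, sm l P <-> sm l Q) -> dimE P = dimE Q.
Proof.
move=> hP hQ h.
have {}h l : dlt (dimE P) l <-> dlt (dimE Q) l.
  by split=> [/(sm_defE _ hP)/h/(sm_defE _ hQ)|/(sm_defE _ hQ)/h/(sm_defE _ hP)].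
case: (dimE P) (dimE Q) h => [a|] [b|] h //; last first.
- by have /= := proj1 (h 0) I.
- by have /= := proj2 (h 0) I.
congr Some; apply/eqP; rewrite eqn_leq -ltnS -[b <= a]ltnS.
by rewrite (proj2 (h b.+1) (ltnSn b)) (proj1 (h a.+1) (ltnSn a)).
Qed.

(** Gives the forward implication without changing the group. *)
Lemma strongly_large_SM n (X : pset M n) : @SM n X -> strongly_large lt dim X.
Proof.
move=> hX; have hX' : Def SM (X : pt M n -> Prop) by [].
have hC : Def SM (closure lt X) by exact: Def_closure.
apply: (sm_dim_eq (Def_SN hX') (Def_SN hC)) => l; split; first exact: sm_closure.
by apply: sm_mono => x; exact: closure_sub.
Qed.

(** * Extension of definable maps to L-definable ones *)

Definition pfib k n (s : 'I_k -> 'I_n) (D : pset M n) (t : pt M k) (x : pt M n) : Prop :=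
  D x /\ forall i, t i = x (s i).

(** Since [D] has dimension at most [k], additivity leaves dimension below [k] for the base of its
    fibres of positive dimension. *)
Lemma sm_pfib_base k n (s : 'I_k -> 'I_n) (D : pt M n -> Prop) :
  sm k.+1 D -> sm k (fun t => ~ sm 1 (pfib s D t)).
Proof.
move=> sD; rewrite -[X in sm X _](subn1 k.+1); apply: (sm_fiber (P := pfib s D)) => //.
have hf : DefFun SN (fun x : pt M n => ((fun i => x (s i)) : pt M k, x)) by ddef.
apply: sm_mono (sm_image hf sD) => -[t x] /= [hx e]; exists x; split=> //.
by congr pair; apply: functional_extensionality.
Qed.

(** If these points had dimension [k], some projection to [k] coordinates would have interior, yet
    every fibre over that image would be infinite, against [sm_pfib_base]. So almost every point
    lies in a finite fibre for some choice of coordinates. *)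
Lemma sm_infinite_fibers k n (D : pt M n -> Prop) : Def SM D -> sm k.+1 D ->
  sm k (fun x => D x /\ forall s : {ffun 'I_k -> 'I_n}, ~ sm 1 (pfib s D (fun i => x (s i)))).
Proof.
move=> hD sD; set D' := (fun x => _).
have hD' : Def SM D'.
  rewrite /D'; apply: (Def_and HM) => //; apply: (Def_fall HM) => s; apply: (Def_not HM).
  have hG : Def SM (fun t : pt M k => sm 1 (pfib s D t)).
    by apply: Def_SM_sm; rewrite /pfib; ddef.
  by apply: (Def_comp HM hG); ddef.
apply/(sm_interior _ hD') => k' s si hi; rewrite ltnNge; apply/negP => kk'.
have sD' : sm k.+1 D' by apply: sm_mono sD => x [].
have k'k := proj1 (sm_interior _ hD') sD' _ _ si hi.
have e : k' = k by apply/eqP; rewrite eqn_leq kk' andbT -ltnS.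
subst k'; have hC : Def SM (cproj s D') by rewrite /cproj; ddef.
apply: (not_sm_of_interior hC hi); apply: sm_mono (sm_pfib_base s sD) => t [x [[_ hx] ht]].
have es : finfun s = s :> (_ -> _) by apply: functional_extensionality => i; rewrite ffunE.
have := hx (finfun s); rewrite es.
by have -> : t = (fun i => x (s i)) by apply: functional_extensionality.
Qed.

Lemma D6_on_type {E} {cE : co M E} (f : E -> M) : DefFun SN f ->
  exists2 F : E -> M, DefFun SM F & sm (@cd M E cE) (fun x => f x <> F x).
Proof.
move=> hf; have hf' : DefFun SN (fun z : pt M (cd E) => f (cof z)) by ddef.
have [F [hF dF]] := D6 Hd hf'.
have {}hF : DefFun SM (F : pt M (cd E) -> M) by exact: hF.
have hFN : DefFun SN (F : pt M (cd E) -> M) by exact: Def_SN.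
have hFN' : Def SN (fun z : pt M (cd E) => f (cof z) <> F z) by ddef.
have sF : sm (cd E) (fun z : pt M (cd E) => f (cof z) <> F z) by apply/(sm_defE _ hFN').
move: F hF {dF hFN hFN'} sF; rewrite /= => F hF sF.
exists (fun x => F (cto x)); first by ddef.
have hc : DefFun SN (fun z : pt M (cd E) => cof z) by ddef.
apply: sm_mono (sm_image hc sF) => x hx.
by exists (cto x); rewrite ctoK.
Qed.

Lemma lt_between n (x d : pt M n) : (forall i, lt (x i) (d i)) -> exists y, box lt x d y.
Proof.
move=> h; have [y hy] := choice (fun i y => lt (x i) y /\ lt y (d i)) (fun i => lt_dense Hlt (h i)).
by exists y.
Qed.

Lemma not_sm_box n (x d : pt M n) : (forall i, lt (x i) (d i)) -> ~ sm n (box lt x d).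
Proof.
move=> h; have hB : Def SM (box lt x d) by rewrite /box; ddef.
by apply: not_sm_of_interior => //; have [y hy] := lt_between h; exists x, d, y.
Qed.

Lemma not_sm_interval (A : M -> Prop) c d : lt c d ->
  (forall y, lt c y -> lt y d -> A y) -> ~ sm 1 A.
Proof.
move=> cd' h sA; have h1 := @not_sm_box 1 (fun=> c) (fun=> d) (fun=> cd').
have hf : DefFun SN (fun (a : M) (_ : 'I_1) => a) by ddef.
apply: h1; apply: sm_mono (sm_image hf sA) => z hz; exists (z ord0); split.
  by apply: h; apply hz.
by apply: functional_extensionality => i; rewrite ord1.
Qed.

Lemma inhabited_M : exists a : M, True.
Proof.
have hT : Def SN (fun _ : M => True) by ddef.
apply: NNPP => h; have h1 : sm 0 (fun _ : M => True) by apply: sm_empty => x _; apply: h; exists x.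
move/(sm_defE _ hT): h1; rewrite /dimE.
by have -> : @dim (cd M) (fun z => True) = Some 1 by exact: (D1_line Hd).
Qed.

Lemma exists_distinct : exists a b : M, a <> b.
Proof.
have [a _] := inhabited_M; have [b hb] := lt_nomax Hlt a.
by exists a, b => ab; rewrite ab in hb; exact: (lt_irr Hlt hb).
Qed.

Section Extend.
Variables (k n : nat) (s : 'I_k -> 'I_n) (D : pt M n -> Prop) (f : pt M n -> M).
Hypotheses (hD : Def SM D) (hf : DefFun SN f).

Let hDN : Def SN D := Def_SN hD.

(* The open region attached to the point [c] of a finite fibre: it has [c] as its
   lower corner and stops before the next coordinates met in the fibre, so that
   the regions of distinct points of the fibre are disjoint. *)
Let region (t : pt M k) (c y : pt M n) : Prop :=
  forall i, lt (c i) (y i) /\ forall c', pfib s D t c' -> lt (c i) (c' i) -> lt (y i) (c' i).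

(** If [c i] is less than [c' i], the first region keeps [y i] below [c' i] and the second keeps it
    above. *)
Lemma region_disjoint t c c' y : pfib s D t c -> pfib s D t c' ->
  region t c y -> region t c' y -> c = c'.
Proof.
move=> hc hc' r r'; apply: functional_extensionality => i.
have [h1 h2] := r i; have [h1' h2'] := r' i.
case: (lt_total Hlt (c i) (c' i)) => [e|[//|e]].
  by case: (lt_irr Hlt (lt_trans Hlt h1' (h2 _ hc' e))).
by case: (lt_irr Hlt (lt_trans Hlt h1 (h2' _ hc e))).
Qed.

(** A finite fibre leaves a gap to the right of [x] in every coordinate. *)
Lemma region_box x : sm 1 (pfib s D (fun i => x (s i))) -> 
  exists2 d, (forall i, lt (x i) (d i)) &
    forall y, box lt x d y -> region (fun i => x (s i)) x y.
Proof.
set t := (fun i => x (s i)) => sx.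
have h i : exists d, lt (x i) d /\ forall c', pfib s D t c' -> lt (x i) (c' i) -> ~ lt (c' i) d.
  pose A a := exists c', pfib s D t c' /\ c' i = a.
  have hA : Def SM A by rewrite /A /pfib; ddef.
  have hi : DefFun SN (fun c : pt M n => c i) by ddef.
  have sA : sm 1 A by apply: sm_mono (sm_image hi sx).
  (* The coordinates met by the fibre form a set of dimension zero, so just to the right of [x i]
     they are all absent rather than all present. *)
  have [d xd [h|h]] := ominimal_right (x i) hA.
    by case: (not_sm_interval xd h sA).
  by exists d; split=> // c' hc' h1 h2; apply: (h _ h1 h2); exists c'.
have [d hd] := choice _ h; exists d => [i|y hy i]; first exact: (hd i).1.
split=> [|c' hc' hlt]; first exact: (hy i).1.
case: (lt_total Hlt (y i) (c' i)) => [//|e]; case: ((hd i).2 _ hc' hlt).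
by case: e => [<-|e]; [exact: (hy i).2 | exact: (lt_trans Hlt e (hy i).2)].
Qed.

Lemma extend_on_finite_fibers : exists2 F : pt M n -> M, DefFun SM F &
  sm k (fun x => D x /\ sm 1 (pfib s D (fun i => x (s i))) /\ f x <> F x).
Proof.
have [m0 _] := inhabited_M.
(* The thickened map: constant with value [f c] on the region of [c], and [m0] outside all
   regions. *)
have [||ft [hft ftP]] := @DefFun_partial _ _ HN (pt M k * pt M n) M _ _
  (fun p v => exists c, pfib s D p.1 c /\ region p.1 c p.2 /\ v = f c) m0.
- by rewrite /region /pfib; ddef.
- move=> [t y] v v' [c [h1 [h2 ->]]] [c' [h1' [h2' ->]]]; congr f.
  exact: region_disjoint h1 h1' h2 h2'.
have [Ft hFt sF] := D6_on_type hft.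
(* (D6) in [k + n] coordinates: over almost all [t] the maps [ft] and [Ft] agree for almost all
   [y]. *)
have sbad : sm k (fun t : pt M k => ~ sm n (fun y : pt M n => ft (t, y) <> Ft (t, y))).
  rewrite -[X in sm X _](addnK n k).
  apply: (sm_fiber (P := fun t y => ft (t, y) <> Ft (t, y))); first exact: leq_addl.
  by apply: sm_mono sF => -[].
have hQ : Def SM (fun p : pt M n * M => exists d : pt M n, (forall i, lt (p.1 i) (d i)) /\
    sm n (fun y => box lt p.1 d y /\ Ft ((fun i => p.1 (s i)), y) <> p.2)).
  apply: (Def_ex HM); apply: (Def_and HM); first by ddef.
  apply: (@Def_SM_sm _ _ _ _ _ (fun (p : pt M n * M * pt M n) y => box lt p.1.1 p.2 y /\
    Ft ((fun i => p.1.1 (s i)), y) <> p.1.2)).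
  by rewrite /box; ddef.
(* [F x] is the generic value of [Ft] on some box with lower corner [x]. *)
have [|F [hF FP]] := DefFun_partial (R := fun x v => exists d : pt M n,
  (forall i, lt (x i) (d i)) /\
  sm n (fun y => box lt x d y /\ Ft ((fun i => x (s i)), y) <> v)) HM m0 hQ.
  move=> x v v' [d [xd h]] [d' [xd' h']]; apply: NNPP => ne.
  have [e he] : exists e : pt M n, forall i, lt (x i) (e i) /\
      forall y, lt y (e i) -> lt y (d i) /\ lt y (d' i).
    apply: (choice (fun i e => lt (x i) e /\ forall y, lt y e -> lt y (d i) /\ lt y (d' i))) => i.
    by have [e h1 h2] := lt_min (xd i) (xd' i); exists e.
  apply: (not_sm_box (fun i => (he i).1)).
  apply: sm_mono (sm_or h h') => y hy.
  have h1 i := (he i).2 _ (hy i).2.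
  case: (classic (Ft ((fun i => x (s i)), y) = v)) => ev; [right | left]; split=> //.
  - by move=> i; split; [exact: (hy i).1 | exact: (h1 i).2].
  - by rewrite ev.
  - by move=> i; split; [exact: (hy i).1 | exact: (h1 i).1].
exists F => //.
have hR : Def SN (fun p : pt M k * pt M n => sm 1 (pfib s D p.1) /\ pfib s D p.1 p.2).
  have hfib : Def SN (fun p : pt M k * pt M n => pfib s D p.1 p.2) by rewrite /pfib; ddef.
  have hG := @Def_sm _ _ _ _ 1 _ hfib.
  by apply: (Def_and HN) hfib; apply: (Def_comp HN hG); ddef.
have h1 (t : pt M k) : sm 1 (fun x => sm 1 (pfib s D t) /\ pfib s D t x).
  case: (classic (sm 1 (pfib s D t))) => h; first by apply: sm_mono h => x [].
  by apply: sm_empty => x [].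
(* The points lying in finite fibres over the exceptional base form a set of dimension below [k]; at
   the remaining ones [f x] is shown to be the generic value. *)
apply: sm_mono (sm_corr (R := fun t x => sm 1 (pfib s D t) /\ pfib s D t x) hR h1 sbad).
move=> x [Dx [sx ne]].
exists (fun i => x (s i)); split; last by [].
move=> sfF; apply: ne; symmetry; apply: FP.
have [d xd hr] := region_box sx; exists d; split=> //.
apply: sm_mono sfF => y [hy hne] e; apply: hne; rewrite -e; apply: ftP.
by exists x; split=> //; split=> //; apply: hr.
Qed.
End Extend.

(** Patch the extensions obtained for the finitely many choices [s] of [k] coordinates; points with
    no finite fibre are negligible by [sm_infinite_fibers]. *)
Lemma extend_scalar k n (D : pt M n -> Prop) (f : pt M n -> M) :
  Def SM D -> DefFun SN f -> sm k.+1 D ->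
  exists2 F : pt M n -> M, DefFun SM F & sm k (fun x => D x /\ f x <> F x).
Proof.
move=> hD hf sD.
have [F hF sF] : exists2 F : pt M n -> M, DefFun SM F & sm k (fun x => D x /\
   (exists2 s : {ffun 'I_k -> 'I_n}, s \in enum {ffun 'I_k -> 'I_n} &
      sm 1 (pfib s D (fun i => x (s i)))) /\ f x <> F x).
  elim: (enum _) => [|s L [F hF sF]].
    (* A default L-definable map starts the induction; with no [s] listed the exceptional set is
       empty. *)
    have [F hF _] := extend_on_finite_fibers (fun i : 'I_n => i) hD hf.
    by exists F => //; apply: sm_empty => x [_ [[]]].
  have [Fs hFs sFs] := extend_on_finite_fibers s hD hf.
  have hG : Def SM (fun x : pt M n => sm 1 (pfib s D (fun i => x (s i)))).
    have hG : Def SM (fun t : pt M k => sm 1 (pfib s D t)).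
      by apply: Def_SM_sm; rewrite /pfib; ddef.
    by apply: (Def_comp HM hG); ddef.
  have [H [hH [H1 H2]]] := DefFun_if HM hG hFs hF.
  exists H => //; apply: sm_mono (sm_or sF sFs) => x [Dx [[s' hs' sx] ne]].
  case: (classic (sm 1 (pfib s D (fun i => x (s i))))) => h.
    by right; split=> //; split=> //; rewrite -H1.
  left; split=> //; split; last by rewrite -H2.
  by exists s' => //; move: hs'; rewrite inE => /orP[/eqP e|//]; rewrite e in sx.
exists F => //; apply: sm_mono (sm_or sF (sm_infinite_fibers hD sD)) => x [Dx ne].
case: (classic (exists2 s : {ffun 'I_k -> 'I_n}, s \in enum {ffun 'I_k -> 'I_n} &
      sm 1 (pfib s D (fun i => x (s i))))) => h; [by left | right; split=> // s hs].
by apply: h; exists s; rewrite ?mem_enum.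
Qed.

Lemma extend_definable {E} {cE : co M E} k m (D : E -> Prop) (f : E -> pt M m) :
  Def SM D -> DefFun SN f -> sm k.+1 D ->
  exists2 F : E -> pt M m, DefFun SM F & sm k (fun x => D x /\ f x <> F x).
Proof.
move=> hD hf sD.
have hD' : Def SM (fun z : pt M (cd E) => D (cof z)) by ddef.
have sD' : sm k.+1 (fun z : pt M (cd E) => D (cof z)).
  by apply/(sm_cof _ (Def_SN hD)).
have h i : exists F : pt M (cd E) -> M, DefFun SM F /\
    sm k (fun z : pt M (cd E) => D (cof z) /\ f (cof z) i <> F z).
  have hfi : DefFun SN (fun z : pt M (cd E) => f (cof z) i) by ddef.
  by have [F ? ?] := extend_scalar hD' hfi sD'; exists F.
have [F hF] := choice _ h.
exists (fun x i => F i (cto x)).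
  apply: (DefFun_vec HM) => i; have hFi := (hF i).1; by ddef.
have hc : DefFun SN (fun z : pt M (cd E) => cof z : E) by ddef.
have := sm_image hc (sm_fUn (fun i => (hF i).2)); apply: sm_mono => x [Dx ne].
exists (cto x); rewrite ctoK; split=> //; apply: NNPP => hn; apply: ne.
apply: functional_extensionality => i; apply: NNPP => hi; apply: hn.
by exists i.
Qed.

(** * Recovering an L-definable group from its chunk *)

Ltac ddefs := repeat first [ progress ddef | match goal with
  | |- Def SN (fun x => sm _ _) => apply Def_sm
  | |- Def SM (fun x => sm _ _) => apply Def_SM_sm
  end ].

Section Group.
Variables (n k : nat).
Variables (G C : pt M n -> Prop) (mul : pt M n -> pt M n -> pt M n)
  (inv : pt M n -> pt M n) (e : pt M n).
Hypotheses (hG : Def SN G) (hmul : DefFun SN (fun p : pt M n * pt M n => mul p.1 p.2))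
  (hinv : DefFun SN inv).
Hypotheses (mulG : forall x y, G x -> G y -> G (mul x y)) (invG : forall x, G x -> G (inv x))
  (oneG : G e)
  (mulA : forall x y z, G x -> G y -> G z -> mul x (mul y z) = mul (mul x y) z)
  (mul1 : forall x, G x -> mul e x = x) (mule : forall x, G x -> mul x e = x)
  (mulV : forall x, G x -> mul x (inv x) = e) (mulVl : forall x, G x -> mul (inv x) x = e).
Hypotheses (hC : Def SM C) (GC : forall x, G x -> C x) (sC : sm k.+1 C) (nG : ~ sm k G).

(** * Cancellation, generic quantification and generic extensions *)

Lemma mulK x y : G x -> G y -> mul (inv x) (mul x y) = y.
Proof. by move=> hx hy; rewrite mulA ?mulVl ?mul1 //; apply: invG. Qed.

Lemma mulVK x y : G x -> G y -> mul x (mul (inv x) y) = y.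
Proof. by move=> hx hy; rewrite mulA ?mulV ?mul1 //; apply: invG. Qed.

Lemma mulIl x y z : G x -> G y -> G z -> mul x y = mul x z -> y = z.
Proof. by move=> hx hy hz h; rewrite -(mulK hx hy) h mulK. Qed.

Lemma mulIr x y z : G x -> G y -> G z -> mul x z = mul y z -> x = y.
Proof.
move=> hx hy hz h; rewrite -(mule hx) -(mule hy) -(mulV hz) !mulA ?h //; exact: invG.
Qed.

Lemma sG : sm k.+1 G. Proof. exact: sm_mono GC sC. Qed.

(* [al P]: almost all elements of [G] satisfy [P]. *)
Definition al (P : pt M n -> Prop) : Prop := sm k (fun y : pt M n => G y /\ ~ P y).

Lemma al_and P Q : al P -> al Q -> al (fun y => P y /\ Q y).
Proof.
move=> hP hQ; apply: sm_mono (sm_or hP hQ) => y [hy h].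
by case: (classic (P y)) => hp; [right | left]; split=> // hq; apply: h.
Qed.

Lemma al_mono (P Q : pt M n -> Prop) : (forall y, G y -> P y -> Q y) -> al P -> al Q.
Proof. by move=> h; apply: sm_mono => y [hy hq]; split=> // /h; auto. Qed.

Lemma al_ex P : al P -> exists2 y, G y & P y.
Proof.
move=> h; apply: NNPP => hn; apply: nG; apply: sm_mono h => y hy; split=> // hp.
by apply: hn; exists y.
Qed.

Lemma al_translate g P : G g -> al P -> al (fun y => P (mul g y)).
Proof.
move=> hg h; have hf : DefFun SN (mul (inv g)).
  by have h1 : DefFun SN (fun y => mul (inv g) y) by ddef.
apply: sm_mono (sm_image hf h) => y [hy hp]; exists (mul g y); split; last exact: mulK.
by split=> //; apply: mulG.
Qed.

(** One common value suffices, by cancellation. Thus an element of [G] is determined by the germ of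
    its left translation. *)
Lemma al_eq_mul h h' : G h -> G h' -> al (fun y => mul h y = mul h' y) -> h = h'.
Proof. by move=> hh hh' /al_ex [y hy]; apply: mulIr. Qed.

Lemma extend_translation g : G g ->
  exists2 L : pt M n -> pt M n, DefFun SM L & al (fun y => L y = mul g y).
Proof.
move=> hg; have hf : DefFun SN (fun y => mul g y) by ddef.
have [L hL sL] := extend_definable hC hf sC.
by exists L => //; apply: sm_mono sL => y [hy ne]; split; [apply: GC | move=> h; apply: ne].
Qed.

(** The square of [C] has dimension at most [k + k], so the extension of the product fails in
    dimension below [k + k]; additivity turns this into two nested generic quantifiers. *)
Lemma extend_mul : exists2 F : pt M n -> pt M n -> pt M n,
  DefFun SM (fun p : pt M n * pt M n => F p.1 p.2) & al (fun x => al (fun y => F x y = mul x y)).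
Proof.
have hCC : Def SM (fun p : pt M n * pt M n => C p.1 /\ C p.2) by ddef.
have sCC : sm (k + k).+1 (fun p : pt M n * pt M n => C p.1 /\ C p.2).
  apply: (sm_total (P := fun x y => C x /\ C y)); first by have := Def_SN hCC.
  move=> l lk; case: (leqP l k) => lk'.
    apply: (@sm_le _ _ k.+1); first by rewrite subSn ?ltnS -?addnBA ?leq_addr //
      (leq_trans lk') ?leq_addr.
    apply: sm_mono sC => x hx; apply: NNPP => hc; apply: hx.
    by apply: sm_empty => y [].
  apply: sm_empty => x []; apply: (sm_le lk'); apply: sm_mono sC => y [] //.
have [F hF sF] := extend_definable hCC hmul sCC.
exists (fun x y => F (x, y)); first by ddef.
have {}sF : sm (k + k) (fun p : pt M n * pt M n => (C p.1 /\ C p.2) /\ mul p.1 p.2 <> F (p.1, p.2)).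
  by apply: sm_mono sF => -[x y].
have := sm_fiber (P := fun x y => (C x /\ C y) /\ mul x y <> F (x, y)) (leq_addl k k) sF.
rewrite addnK; apply: sm_mono => x [hx hn] hs; apply: hn; apply: sm_mono hs => y [hy ne].
by split; [split; apply: GC | move=> h1; apply: ne].
Qed.

(** Extend the indicator function of [G], coded by two distinct elements of [M], from the closed set
    up to a small error. *)
Lemma SM_approximation : exists W : pt M n -> Prop, [/\ Def SM W,
  sm k (fun x => W x /\ ~ G x) & sm k (fun x => G x /\ ~ W x)].
Proof.
have [a [b ab]] := exists_distinct.
have [f [hf [f1 f2]]] := DefFun_if HN hG
  (DefFun_const HN (fun _ : 'I_1 => a)) (DefFun_const HN (fun _ : 'I_1 => b)).
have [F hF sF] := extend_definable hC hf sC.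
exists (fun x => C x /\ F x = (fun _ => a)); split; first by ddef.
- apply: sm_mono sF => x [[hx ex] ng]; split=> //.
  rewrite f2 // ex => /(congr1 (fun z => z ord0)) /=.
  by move=> h; apply: ab.
- apply: sm_mono sF => x [hg nw]; split; first exact: GC.
  by rewrite f1 // => ex; apply: nw; split=> //; apply: GC.
Qed.

Section Covering.
Variable X : pt M n -> Prop.
Hypotheses (hX : Def SN X) (alX : al X).

(* Each translate can be chosen to lower the dimension of the uncovered part. *)
Lemma finite_cover d (Y : pt M n -> Prop) : Def SN Y -> (forall y, Y y -> G y) -> sm d Y ->
  exists gs : seq (pt M n), (forall g, List.In g gs -> G g) /\
    forall y, Y y -> exists g, List.In g gs /\ X (mul (inv g) y).
Proof.
elim: d Y => [|d IH] Y hY YG sY.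
  by exists [::]; split=> // y hy; case: (sm_zero sY hy).
have hZ : Def SN (fun p : pt M n * pt M n => Y p.1 /\ G p.2 /\ ~ X (mul (inv p.2) p.1)) by ddef.
(* Count the pairs of a point [y] and a translate missing it: for each [y] almost no [g] is bad, so
   after swapping some [g] misses only a part of [Y] of smaller dimension. *)
have sZ : sm (d + k) (fun p : pt M n * pt M n => Y p.1 /\ G p.2 /\ ~ X (mul (inv p.2) p.1)).
  apply: (sm_total (P := fun y g => Y y /\ G g /\ ~ X (mul (inv g) y))) => // l ld.
  case: (leqP k l) => kl; last first.
    apply: (@sm_le _ _ d.+1).
      by rewrite -addnBA ?(ltnW kl) // -addn1 leq_add2l subn_gt0.
    apply: sm_mono sY => y hy; apply: NNPP => ny; apply: hy.
    by apply: sm_empty => g [].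
  apply: sm_empty => y []; apply: (sm_le kl).
  case: (classic (Y y)) => hy; last by apply: sm_empty => g [].
  (* This map sends [mul (inv g) y] back to [g], so the bad [g] are an image of the part of [G]
     outside [X]. *)
  have hf : DefFun SN (fun z => mul y (inv z)) by ddef.
  apply: sm_mono (sm_image hf alX) => g [_ [hg nX]].
  have hy' := YG _ hy; have hig := invG hg.
  exists (mul (inv g) y); split; first by split=> //; apply: mulG.
  have h1 := mulG hig hy'.
  by apply: (mulIr (z := mul (inv g) y)) => //; [apply: mulG => //; apply: invG
    | rewrite -mulA ?mulVl ?mule ?mulVK //; apply: invG].
have := sm_fiber (P := fun g y => Y y /\ G g /\ ~ X (mul (inv g) y)) (leq_addr k d)
  (sm_swap (P := fun y g => Y y /\ G g /\ ~ X (mul (inv g) y)) sZ).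
rewrite addKn => sg.
have [g hg sYg] : exists2 g, G g & sm d (fun y => Y y /\ G g /\ ~ X (mul (inv g) y)).
  apply: NNPP => hn; apply: nG; apply: sm_mono sg => g hg hs.
  by apply: hn; exists g.
have hYg : Def SN (fun y => Y y /\ ~ X (mul (inv g) y)) by ddef.
have [||gs [gsG hgs]] := IH _ hYg.
- by move=> y [/YG].
- by apply: sm_mono sYg => y [].
exists (g :: gs); split=> [g' [<-|/gsG]|y hy] //.
case: (classic (X (mul (inv g) y))) => hx; first by exists g; split=> //; left.
by have [|g' [h1 h2]] := hgs y; [|exists g'; split=> //; right].
Qed.
End Covering.

(** * Points representing group elements by germs *)

Section Chunk.
Variables (W : pt M n -> Prop) (F : pt M n -> pt M n -> pt M n).
Hypotheses (hW : Def SM W) (sWG : sm k (fun x => W x /\ ~ G x))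
  (sGW : sm k (fun x => G x /\ ~ W x)).
Hypotheses (hF : DefFun SM (fun p : pt M n * pt M n => F p.1 p.2))
  (alF : al (fun x => al (fun y => F x y = mul x y))).

Let hWN : Def SN W := Def_SN hW.
Let hFN : DefFun SN (fun p : pt M n * pt M n => F p.1 p.2) := Def_SN hF.

(* On the [SM]-definable set [W] the quantifier [al] becomes [SM]-definable. *)
Definition alW (P : pt M n -> Prop) : Prop := sm k (fun y : pt M n => W y /\ ~ P y).

Lemma alW_al P : alW P <-> al P.
Proof.
split=> h.
  apply: sm_mono (sm_or h sGW) => y [hy hp].
  by case: (classic (W y)) => hw; [left | right].
apply: sm_mono (sm_or h sWG) => y [hy hp].
by case: (classic (G y)) => hg; [left | right].
Qed.

Lemma al_W : al W. Proof. exact: sGW. Qed.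

(** Refers to [mul], hence serves in proofs only; [chunk1] is its L-definable substitute. *)
Let nice x := al (fun y => F x y = mul x y).

(* The second clause makes [F a] commute generically with right translations; the
   third makes preimages of small sets under [F a] small, so that [F a y] lies in
   [G] for almost all [y]. *)
Definition chunk1 a := W a /\
  alW (fun y => alW (fun z => F a (F y z) = F (F a y) z)) /\
  alW (fun y => W (F a y) /\ forall y', W y' -> F a y' = F a y -> y' = y).

(** Points sharing their germ with another point are discarded, so that representation is injective
    without a choice of representatives. The loss is negligible by [al_covered]. *)
Definition chunk a := chunk1 a /\
  forall b, chunk1 b -> alW (fun y => F a y = F b y) -> b = a.

Lemma Def_chunk1 : Def SM chunk1.
Proof. by rewrite /chunk1 /alW; ddefs. Qed.

Lemma Def_chunk : Def SM chunk.
Proof. by have h := Def_chunk1; rewrite /chunk /alW; ddefs. Qed.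

Lemma nice_chunk1 x : G x -> nice x -> W x -> chunk1 x.
Proof.
move=> hx nx wx; split=> //; split; apply/alW_al.
  apply: al_mono (al_and alF (al_and nx (al_translate hx alF))) => y hy [ny [e1 nxy]].
  apply/alW_al; rewrite e1.
  apply: al_mono (al_and ny (al_and (al_translate hy nx) nxy)) => z hz [-> [-> ->]].
  exact: mulA.
have sN : sm k (fun y' => W y' /\ ~ (G y' /\ F x y' = mul x y')).
  apply/alW_al; apply: al_mono nx => y hy h; by [].
have hFx : DefFun SN (F x) by have h : DefFun SN (fun y => F x y) by ddef.
(* Almost no element is a value of [F x] at a point where [F x] is not multiplication by [x], so
   generic injectivity reduces to cancellation. *)
have al1 : al (fun y => ~ exists y', (W y' /\ ~ (G y' /\ F x y' = mul x y')) /\ F x y' = y).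
  by apply: sm_mono (sm_image hFx sN) => y [_ /NNPP].
apply: al_mono (al_and nx (al_and (al_translate hx al1) (al_translate hx al_W))).
move=> y hy [e1 [h2 wy]]; rewrite e1; split=> // y' wy' e2.
have [hy' e3] : G y' /\ F x y' = mul x y' by apply: NNPP => hn; apply: h2; exists y'.
by apply: (mulIl hx) => //; rewrite -e3.
Qed.

(** For generic [y] the point [F a y] is a nice element of [G], and generic associativity gives
    [F a (mul y z) = mul (F a y) z]. So [F a] is generically multiplication by [F a y] times the
    inverse of [y], even when [a] lies outside [G]. *)
Lemma chunk1_rep a : chunk1 a -> exists2 h, G h & al (fun y => F a y = mul h y).
Proof.
move=> [wa [/alW_al c1 c2]].
have sN : sm k (fun x => W x /\ ~ (G x /\ nice x)).
  apply/alW_al; apply: al_mono alF => x hx h; by [].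
have hR : Def SN (fun p : pt M n * pt M n => W p.2 /\ F a p.2 = p.1 /\
    forall y', W y' -> F a y' = F a p.2 -> y' = p.2) by ddef.
have al1 : al (fun y => G (F a y) /\ nice (F a y)).
  have h1 z : sm 1 (fun y => W y /\ F a y = z /\ forall y', W y' -> F a y' = F a y -> y' = y).
    by apply: sm_sub1 => y y' [wy [e1 i1]] [wy' [e2 i2]]; apply: i2; rewrite ?e1.
  have sI := sm_corr (R := fun z y => W y /\ F a y = z /\
    forall y', W y' -> F a y' = F a y -> y' = y) hR h1 sN.
  apply: sm_mono (sm_or c2 (sm_or sGW sI)) => y [hy hn].
  case: (classic (W y)) => wy; last by right; left.
  case: (classic (W (F a y) /\ forall y', W y' -> F a y' = F a y -> y' = y)) => [[h2 h3]|h2].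
    by right; right; exists (F a y).
  by left.
have [y hy [[hFy nFy] h]] : exists2 y, G y & (G (F a y) /\ nice (F a y)) /\
    al (fun z => F a (mul y z) = mul (F a y) z).
  apply: al_ex; apply: al_and => //.
  apply: al_mono (al_and alF (al_and al1 c1)) => y hy [ny [[hFy nFy] /alW_al h]].
  apply: al_mono (al_and ny (al_and nFy h)) => z hz [e1 [e2 e3]].
  by rewrite -e1 e3 e2.
exists (mul (F a y) (inv y)); first by apply: mulG => //; apply: invG.
apply: al_mono (al_translate (invG hy) h) => w hw; rewrite mulVK // => ->.
by rewrite mulA //; apply: invG.
Qed.

Let X h := exists a, chunk a /\ G h /\ al (fun y => F a y = mul h y).

Lemma Def_covered : Def SN X.
Proof. by have h := Def_SN Def_chunk; rewrite /X /al; ddefs. Qed.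

(** A nice [h] in [W] represents itself unless another point [b] shares its germ. Such a [b] cannot
    be a nice element of [G], so it lies in a small set, and each [b] spoils at most one [h]. *)
Lemma al_covered : al X.
Proof.
have sN : sm k (fun x => W x /\ ~ (G x /\ nice x)).
  apply/alW_al; apply: al_mono alF => x hx h; by [].
have hR : Def SN (fun p : pt M n * pt M n => G p.2 /\ al (fun y => F p.1 y = mul p.2 y)).
  by rewrite /al; ddefs.
have h1 b : sm 1 (fun h => G h /\ al (fun y => F b y = mul h y)).
  apply: sm_sub1 => h h' [hh e1] [hh' e2]; apply: al_eq_mul => //.
  by apply: al_mono (al_and e1 e2) => y _ [<- <-].
have sI := sm_corr (R := fun b h => G h /\ al (fun y => F b y = mul h y)) hR h1 sN.
apply: sm_mono (sm_or alF (sm_or sGW sI)) => h [hh nX].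
case: (classic (nice h)) => nh; [right | by left].
case: (classic (W h)) => wh; [right | by left].
have ch := nice_chunk1 hh nh wh.
apply: NNPP => hn; apply: nX; exists h; split=> //; split=> // b hb /alW_al eb.
have rb : al (fun y => F b y = mul h y) by apply: al_mono (al_and eb nh) => y _ [<-].
have [gb nb] : G b /\ nice b.
  apply: NNPP => hnb; apply: hn; exists b; split; last by split.
  by split=> //; apply hb.
apply: al_eq_mul => //.
by apply: al_mono (al_and nb rb) => y _ [<- <-].
Qed.

(* A chart for [Y]: [v] in [V] stands for the element [h] of [Y] whose left
   translation agrees generically with [A v]. *)
Definition chart (Y : pt M n -> Prop) : Prop :=
  exists (T : Type) (cT : co M T) (V : T -> Prop) (A : T -> pt M n -> pt M n),
  [/\ Def SM V, DefFun SM (fun p : T * pt M n => A p.1 p.2),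
      forall v, V v -> exists h, [/\ G h, Y h & al (fun y => A v y = mul h y)],
      forall h, G h -> Y h -> exists2 v, V v & al (fun y => A v y = mul h y) &
      forall v v', V v -> V v' -> al (fun y => A v y = A v' y) -> v = v'].

(** * Gluing translated charts *)

(** Translation by [g] is replaced by its L-definable extension [L]; composing with [F a] turns the
    germ of [h] into that of [mul g h]. *)
Lemma chart_translate g : G g -> chart (fun h => X (mul (inv g) h)).
Proof.
move=> hg; have [L hL alL] := extend_translation hg.
have rep a h : G h -> al (fun y => F a y = mul h y) -> al (fun y => L (F a y) = mul (mul g h) y).
  move=> hh r; apply: al_mono (al_and r (al_translate hh alL)) => y hy [-> ->].
  exact: mulA.
have hch := Def_chunk.
exists (pt M n), _, chunk, (fun a y => L (F a y)); split=> //.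
- by ddef.
- move=> a ha; have [h hh r] := chunk1_rep ha.1.
  exists (mul g h); split; [exact: mulG | | exact: rep].
  by rewrite mulK //; exists a.
- move=> h hh [a [ha [h1 r]]]; exists a => //.
  by have := rep _ _ h1 r; rewrite mulVK.
- move=> a b ha hb hab.
  have [h hh r] := chunk1_rep ha.1; have [h' hh' r'] := chunk1_rep hb.1.
  have eh : h = h'.
    apply: (mulIl hg) => //; apply: al_eq_mul; [exact: mulG | exact: mulG |].
    by apply: al_mono (al_and hab (al_and (rep _ _ hh r) (rep _ _ hh' r'))) => y _ [-> [-> ->]].
  apply: hb.2; first exact: ha.1.
  by apply/alW_al; apply: al_mono (al_and r r') => y _ [-> ->]; rewrite eh.
Qed.

(** The tags [a] and [b] separate the two charts. The second keeps only points whose germ is absent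
    from the first, a condition that [alW] makes L-definable. *)
Lemma chart_union Y1 Y2 : chart Y1 -> chart Y2 -> chart (fun h => Y1 h \/ Y2 h).
Proof.
move=> [T1 [cT1 [V1 [A1 [hV1 hA1 r1 s1 i1]]]]] [T2 [cT2 [V2 [A2 [hV2 hA2 r2 s2 i2]]]]].
have [a [b ab]] := exists_distinct.
(* Fixed padding for the component that the tag leaves idle; without it a point would have several
   codes. *)
pose d1 : T1 := @cof M T1 cT1 (fun=> a); pose d2 : T2 := @cof M T2 cT2 (fun=> a).
have hP : Def SM (fun p : (M * (T1 * T2)) * pt M n => p.1.1 = a) by ddef.
have hf1 : DefFun SM (fun p : (M * (T1 * T2)) * pt M n => A1 p.1.2.1 p.2) by ddef.
have hf2 : DefFun SM (fun p : (M * (T1 * T2)) * pt M n => A2 p.1.2.2 p.2) by ddef.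
have [A [hA [Aa Ab]]] := DefFun_if HM hP hf1 hf2.
have Aa' v w y : A ((a, (v, w)), y) = A1 v y by rewrite Aa.
have Ab' v w y : A ((b, (v, w)), y) = A2 w y by rewrite Ab //= => h; apply: ab.
exists (M * (T1 * T2))%type, _, (fun v => (v.1 = a /\ V1 v.2.1 /\ v.2.2 = d2) \/
  (v.1 = b /\ V2 v.2.2 /\ v.2.1 = d1 /\ forall w, V1 w -> ~ alW (fun y => A1 w y = A2 v.2.2 y))),
  (fun v y => A (v, y)); split.
- by rewrite /alW; ddefs.
- by ddef.
- move=> [c [v w]] /= [[-> [hv ->]]|[-> [hw [-> _]]]].
    have [h [hh hy r]] := r1 _ hv; exists h; split=> //; first by left.
    by apply: al_mono r => y _ <-.
  have [h [hh hy r]] := r2 _ hw; exists h; split=> //; first by right.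
  by apply: al_mono r => y _ <-.
- move=> h hh hY.
  case: (classic (exists2 v, V1 v & al (fun y => A1 v y = mul h y))) => [[v hv r]|hn].
    exists (a, (v, d2)); first by left.
    by apply: al_mono r => y _ <-.
  have {}hY : Y2 h by case: hY => // /(s1 _ hh).
  have [w hw r] := s2 _ hh hY; exists (b, (d1, w)); last by apply: al_mono r => y _ <-.
  right; do 3!split=> //; move=> v hv /alW_al h1; apply: hn; exists v => //.
  by apply: al_mono (al_and h1 r) => y _ [-> ->].
- have e1 v w w' : al (fun y => A ((a, (v, w)), y) = A ((b, (d1, w')), y)) ->
      alW (fun y => A1 v y = A2 w' y).
    by move=> h; apply/alW_al; apply: al_mono h => y _; rewrite Aa' Ab'.
  move=> [c [v w]] [c' [v' w']] /=.
  move=> [[-> [hv ->]]|[-> [hw [-> hn]]]] [[-> [hv' ->]]|[-> [hw' [-> hn']]]] h.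
  + by rewrite (i1 v v') //; apply: al_mono h => y _; rewrite !Aa'.
  + by case: (hn' v hv); apply: e1 h.
  + by case: (hn v' hv'); apply: (e1 _ d2); apply: al_mono h => y _ ->.
  + by rewrite (i2 w w') //; apply: al_mono h => y _; rewrite !Ab'.
Qed.

(** Finitely many translates of the represented elements cover [G]; their charts are joined by
    induction on the list. *)
Lemma chart_full : chart (fun _ => True).
Proof.
have [gs [gsG hgs]] := finite_cover Def_covered al_covered hG (fun y h => h) sG.
have [T [cT [V [A [hV hA r s i]]]]] : chart (fun h => exists g, List.In g gs /\ X (mul (inv g) h)).
  elim: gs gsG {hgs} => [_|g gs IH hgs].
    exists (pt M n), _, (fun _ => False), F; split=> //; first by ddef.
    by move=> h _ [g []].
  have [T [cT [V [A [hV hA r s i]]]]] := chart_union (chart_translate (hgs g (or_introl erefl)))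
    (IH (fun g' h => hgs g' (or_intror h))).
  exists T, cT, V, A; split=> //.
    move=> v /r [h [hh hY al1]]; exists h; split=> //.
    case: hY => [hx|[g' [h1 h2]]]; first by exists g; split=> //; left.
    by exists g'; split=> //; right.
  move=> h hh [g' [[<-|h1] h2]]; apply: s => //; first by left.
  by right; exists g'.
exists T, cT, V, A; split=> //.
  by move=> v /r [h [hh _ al1]]; exists h.
by move=> h hh _; apply: s => //; apply: hgs.
Qed.

(** * The L-definable group on the full chart *)

(** [th] sends an element to the unique chart point with its germ. This map is definable only in the
    expansion, while the universe and product of the new group are L-definable. *)
Lemma chunk_group :
  exists m (V : pset M m) (mul' : pt M m -> pt M m -> pt M m) (f : pt M n -> pt M m),
  dgroup SM V mul' /\ def_iso SN G mul V mul' f.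
Proof.
have [T [cT [V [A [hV hA rep onto inj]]]]] := chart_full.
have hVN := Def_SN hV.
have hAN : DefFun SN (fun p : T * pt M n => A p.1 p.2) by exact: Def_SN.
have [ve hve _] := onto e oneG I.
have [||th [hth thP]] := @DefFun_partial _ _ HN (pt M n) T _ _
  (fun h v => G h /\ V v /\ al (fun y => A v y = mul h y)) ve.
- by rewrite /al; ddefs.
- move=> h v v' [_ [hv r]] [_ [hv' r']]; apply: inj => //.
  by apply: al_mono (al_and r r') => y _ [-> ->].
have {}thP h : G h -> V (th h) /\ al (fun y => A (th h) y = mul h y).
  by move=> hh; have [v hv r] := onto h hh I; rewrite (thP h v).
have th_inj h h' : G h -> G h' -> th h = th h' -> h = h'.
  move=> hh hh' eh; apply: al_eq_mul => //.
  by apply: al_mono (al_and (thP h hh).2 (thP h' hh').2) => y _ [<- <-]; rewrite eh.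
have th_onto v : V v -> exists2 h, G h & th h = v.
  move=> hv; have [h [hh _ r]] := rep v hv; exists h => //.
  apply: inj => //; first exact: (thP h hh).1.
  by apply: al_mono (al_and r (thP h hh).2) => y _ [-> ->].
(* The product is read off from composed germs, with [alW] instead of [al], so that neither [G] nor
   [mul] enters its definition. *)
have [||mu [hmu muP]] := @DefFun_partial _ _ HM (T * T) T _ _
  (fun p u => V p.1 /\ V p.2 /\ V u /\ alW (fun y => A p.1 (A p.2 y) = A u y)) ve.
- by rewrite /alW; ddefs.
- move=> p u u' [_ [_ [hu /alW_al r]]] [_ [_ [hu' /alW_al r']]]; apply: inj => //.
  by apply: al_mono (al_and r r') => y _ [<- <-].
have muE h h' : G h -> G h' -> mu (th h, th h') = th (mul h h').
  move=> hh hh'; apply: muP.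
  have [v1 r1] := thP h hh; have [v2 r2] := thP h' hh'; have [v3 r3] := thP _ (mulG hh hh').
  do 3!split=> //; apply/alW_al => /=.
  apply: al_mono (al_and r2 (al_and r3 (al_translate hh' r1))) => y hy [-> [-> ->]].
  exact: mulA.
have hVz : Def SM (fun z : pt M (cd T) => V (cof z)) by ddef.
pose tz h := @cto M T cT (th h).
have tzV h : G h -> V (@cof M T cT (tz h)) by move=> hh; rewrite /tz ctoK; exact: (thP h hh).1.
have tz_onto z : V (@cof M T cT z) -> exists2 h, G h & tz h = z.
  by move=> /th_onto [h hh eh]; exists h; rewrite // /tz eh cofK.
exists (@cd M T cT), (fun z => V (cof z)), (fun z w => cto (mu (cof z, cof w))), tz.
have tzM h h' : G h -> G h' -> cto (mu (cof (tz h), cof (tz h'))) = tz (mul h h').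
  by move=> hh hh'; rewrite /tz !ctoK muE.
split; last split; [split => // | | split; [|split; [|split]]].
- have h : Def SM (fun p : (pt M (cd T) * pt M (cd T)) * pt M (cd T) => V (cof p.1.1) /\
    V (cof p.1.2) /\ cto (mu (cof p.1.1, cof p.1.2)) = p.2) by ddef.
  exact: h.
- by move=> z w /tz_onto [h hh <-] /tz_onto [h' hh' <-]; rewrite tzM //; apply: tzV; apply: mulG.
- move=> x y z /tz_onto [h1 hh1 <-] /tz_onto [h2 hh2 <-] /tz_onto [h3 hh3 <-].
  by rewrite !tzM ?mulA //; apply: mulG.
- exists (tz e); split; first exact: tzV.
  split=> x /tz_onto [h hh <-]; first by rewrite !tzM // mul1 // mule.
  by exists (tz (inv h)); rewrite !tzM ?mulV ?mulVl //;
    [split; first exact/tzV/invG | exact: invG..].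
- have h : Def SN (fun p : pt M n * pt M (cd T) => G p.1 /\ cto (th p.1) = p.2) by ddef.
  exact: h.
- exact: tzV.
- move=> h h' hh hh' eh; apply: th_inj => //.
  by rewrite -(ctoK (th h)) -(ctoK (th h')); congr cof.
- by move=> z /tz_onto [h hh eh]; exists h.
- by move=> h h' hh hh'; rewrite tzM.
Qed.
End Chunk.

Lemma SM_group : exists m (V : pset M m) (mul' : pt M m -> pt M m -> pt M m) (f : pt M n -> pt M m),
  dgroup SM V mul' /\ def_iso SN G mul V mul' f.
Proof.
have [W [hW sWG sGW]] := SM_approximation; have [F hF alF] := extend_mul.
exact: chunk_group hW sWG sGW hF alF.
Qed.
End Group.

(** * From strongly large groups to the equivalence *)

Lemma closure_compl_open n (X : pset M n) : is_open lt (fun x => ~ closure lt X x).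
Proof.
move=> x hx.
have [a [b [hb hn]]] : exists a b, box lt a b x /\ ~ exists y, box lt a b y /\ X y.
  apply: NNPP => h; apply: hx => a b hb; apply: NNPP => hn; apply: h.
  by exists a, b.
by exists a, b; split=> // y hy hc; apply: hn; apply: hc.
Qed.

Lemma strongly_large_SM_group n (U : pset M n) mul :
  (forall m (A : pset M m), @SN m A -> is_open lt A -> @SM m A) ->
  dgroup SN U mul -> strongly_large lt dim U ->
  exists m (V : pset M m) (mul' : pt M m -> pt M m -> pt M m) (f : pt M n -> pt M m),
    dgroup SM V mul' /\ def_iso SN U mul V mul' f.
Proof.
move=> hO [hU hop hcl hA [e [he [h1 hV]]]] hsl.
have hU' : Def SN (U : pt M n -> Prop) by [].
have hopN : Def SN (fun p : (pt M n * pt M n) * pt M n =>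
    U p.1.1 /\ U p.1.2 /\ mul p.1.1 p.1.2 = p.2).
  exact: hop.
have hclN : Def SN (closure lt U) by exact: Def_closure.
(* The assumption on open definable sets enters here, for the complement of the closure. *)
have hclM : Def SM (closure lt U).
  have h : Def SM (fun x => ~ closure lt U x).
    by apply: hO; [exact: (Def_not HN hclN) | exact: closure_compl_open].
  by apply: (Def_ext HM) (Def_not HM h) => x; split=> [/NNPP|hx []].
have hsl' : dimE (U : pt M n -> Prop) = dimE (closure lt U) by exact: hsl.
case ek : (@dimE _ (co_pt M n) U) => [k|]; last first.
  have h0 : sm 0 (U : pt M n -> Prop) by apply/(sm_defE _ hU'); rewrite ek.
  by case: (sm_zero h0 he).
have sC : sm k.+1 (closure lt U) by apply/(sm_defE _ hclN); rewrite -hsl' ek /=.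
have nU : ~ sm k (U : pt M n -> Prop) by move/(sm_defE _ hU'); rewrite ek /= ltnn.
(* Only the graph of [mul] over [U] is known to be definable; [m] agrees with it there and takes the
   value [e] elsewhere, which makes it definable as a total map. *)
have [|m [hm mP]] := @DefFun_partial _ _ HN (pt M n * pt M n) (pt M n) _ _
  (fun p v => U p.1 /\ U p.2 /\ mul p.1 p.2 = v) e hopN.
  by move=> p v v' [_ [_ <-]] [_ [_ <-]].
have mE x y : U x -> U y -> m (x, y) = mul x y by move=> hx hy; apply: mP.
have [||inv [hinv iP]] := @DefFun_partial _ _ HN (pt M n) (pt M n) _ _
  (fun x y => U x /\ U y /\ m (x, y) = e /\ m (y, x) = e) e.
- by ddef.
- move=> x y y' [hx [hy [xy yx]]] [_ [hy' [xy' _]]].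
  rewrite -(proj2 (h1 y hy)) -xy' mE // hA // -(mE y x) // yx.
  by rewrite (proj1 (h1 _ hy')).
have {}iP x : U x -> [/\ U (inv x), m (x, inv x) = e & m (inv x, x) = e].
  move=> hx; have [y [hy [xy yx]]] := hV x hx.
  by rewrite (iP x y) ?mE //; split=> //; split=> //; rewrite !mE.
have [N [V [mul' [f [gV [i1 [i2 [i3 [i4 i5]]]]]]]]] :
    exists N (V : pset M N) (mul' : pt M N -> pt M N -> pt M N) (f : pt M n -> pt M N),
    dgroup SM V mul' /\ def_iso SN U (fun x y => m (x, y)) V mul' f.
  have hm' : DefFun SN (fun p : pt M n * pt M n => m (p.1, p.2)) by ddef.
  apply: (@SM_group n k U (closure lt U) (fun x y => m (x, y)) inv e hU' hm' hinv) => //.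
  - by move=> x y hx hy; rewrite mE //; apply: hcl.
  - by move=> x /iP [].
  - by move=> x y z hx hy hz; rewrite !mE ?hA //; apply: hcl.
  - by move=> x hx; rewrite mE // (proj1 (h1 x hx)).
  - by move=> x hx; rewrite mE // (proj2 (h1 x hx)).
  - by move=> x /iP [].
  - by move=> x /iP [].
  - by move=> x; exact: closure_sub.
exists N, V, mul', f; split=> //; do 4!split=> //.
by move=> x y hx hy; rewrite -mE // i5.
Qed.

Lemma def_iso_comp n m p (U : pset M n) mulU (V : pset M m) mulV (W : pset M p) mulW f g :
  def_iso SN U mulU V mulV f -> def_iso SN V mulV W mulW g ->
  def_iso SN U mulU W mulW (fun x => g (f x)).
Proof.
move=> [f1 [f2 [f3 [f4 f5]]]] [g1 [g2 [g3 [g4 g5]]]].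
have hf : Def SN (fun q : pt M n * pt M m => U q.1 /\ f q.1 = q.2) by exact: f1.
have hg : Def SN (fun q : pt M m * pt M p => V q.1 /\ g q.1 = q.2) by exact: g1.
split; last split; [| by move=> x /f2 /g2 | split; [|split]].
(* Both maps are definable only over their universes, so the graph of the composite is written with
   an intermediate point of [V]. *)
- have h : Def SN (fun q : pt M n * pt M p => exists y, (U q.1 /\ f q.1 = y) /\ (V y /\ g y = q.2)).
    apply: (Def_ex HN); apply: (Def_and HN).
      by apply: (Def_comp2 HN (P := fun x y => U x /\ f x = y) hf); ddef.
    by apply: (Def_comp2 HN (P := fun x y => V x /\ g x = y) hg); ddef.
  have h' : Def SN (fun q : pt M n * pt M p => U q.1 /\ g (f q.1) = q.2).
    apply: (Def_ext HN) h => -[x z] /=; split=> [[y [[hx <-] [_ <-]]]|[hx <-]] //.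
    by exists (f x); do 2!split=> //; apply: f2.
  exact: h'.
- by move=> x x' hx hx' /g3 h; apply: f3 => //; apply: h; apply: f2.
- by move=> z /g4 [y [/f4 [x [hx <-]] <-]]; exists x.
- by move=> x y hx hy; rewrite f5 // g5 //; apply: f2.
Qed.

Lemma dgroup_SN n (U : pset M n) mul : dgroup SM U mul -> dgroup SN U mul.
Proof. by case=> h1 h2 h3 h4 h5; split=> //; apply: HMN. Qed.

End Dimension.

Theorem theorem1p1 (M : Type) (lt : M -> M -> Prop) (SM SN : dsys M)
    (dim : forall n, pset M n -> option nat) :
  dlo lt ->
  ominimal lt SM ->
  is_structure SN ->
  (forall n (A : pset M n), SM n A -> SN n A) ->
  (forall n (A : pset M n), SN n A -> is_open lt A -> SM n A) ->
  dim_fun lt SM SN dim ->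
  forall n (U : pset M n) (mul : pt M n -> pt M n -> pt M n),
    dgroup SN U mul ->
    ((exists m (V : pset M m) (mul' : pt M m -> pt M m -> pt M m) (f : pt M n -> pt M m),
        dgroup SM V mul' /\ def_iso SN U mul V mul' f) <->
     (exists m (V : pset M m) (mul' : pt M m -> pt M m -> pt M m) (f : pt M n -> pt M m),
        dgroup SN V mul' /\ strongly_large lt dim V /\ def_iso SN U mul V mul' f)).
Proof.
move=> Hlt Hom HN HMN HO Hd n U mul hU; split=> -[m [V [mul' [f]]]].
  move=> [gV iso]; exists m, V, mul', f; split; first exact: dgroup_SN gV.
  by split=> //; exact: (strongly_large_SM Hlt Hom HN HMN Hd (g_univ gV)).
move=> [gV [sV iso]].
have [p [W [mulW [g [gW iso']]]]] := strongly_large_SM_group Hlt Hom HN HMN Hd HO gV sV.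
by exists p, W, mulW, (fun x => g (f x)); split=> //; exact: def_iso_comp iso iso'.
Qed.
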